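(* Let $\mathcal{R}$ be the (possibly multibranch) plane curve singularity ring $\mathcal{R}=\mathbb{F}_q[[x,y]]/(F(x,y))$, where $F=\prod_{i=1}^\kappa F_i$ with pairwise non-proportional, absolutely irreducible $F_i$, and let $\delta=\dim_{\mathbb{F}_q}(\mathcal{O}/\mathcal{R})$. Then the $a$-extended $L$-function $L(q,t,a)$ of $\mathcal{R}$ satisfies the functional equation $$q^{\delta}t^{2\delta}L\Bigl(q,\frac1{qt},a\Bigr)=L(q,t,a);$$ equivalently, $t^{-\delta}L(q,t,a)$ is invariant under $t\mapsto1/(qt)$, $a\mapsto a$.
   Context: Let $F_i(x,y)$, $1\le i\le\kappa$, be pairwise non-proportional polynomials over $\mathbb{F}_q$ defining branches at $(0,0)$ that are irreducible over the algebraic closure of $\mathbb{F}_q$. The ring $\mathcal{R}$ is embedded in its normalization $\mathcal{O}=\oplus_{i=1}^\kappa\mathcal{O}_i$, $\mathcal{O}_i=\mathbb{F}_q[[z_i]]$; the images of $x,y$ lie in $\oplus_iz_i\mathcal{O}_i$, the projection $\mathcal{R}_i\cong\mathbb{F}_q[[x,y]]/(F_i)$ of $\mathcal{R}$ to $\mathcal{O}_i$ has field of fractions $\mathbb{F}_q((z_i))$ and residue field $\mathbb{F}_q$. Let $\mathfrak{m}_{\mathcal R}$ be the maximal ideal of $\mathcal{R}$. Define $$Z(q,t,a)=\sum_{M}t^{\deg_{\mathcal R}(M)}\prod_{j=1}^{rk_q(M)-1}(1+aq^j),\qquad L(q,t,a)=(1-t)^\kappa Z(q,t,a),$$ where the sum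 is over all ideals $M\subset\mathcal{R}$ with $\deg_{\mathcal R}(M)=\dim_{\mathbb{F}_q}(\mathcal{R}/M)<\infty$, $rk_q(M)=\dim_{\mathbb{F}_q}(M/\mathfrak{m}_{\mathcal R}M)$, and empty products are $1$. Here $q$ is the fixed number of elements of the field and $t,a$ are variables; $L(q,t,a)$ is a polynomial in $t$ and $a$, so the substitution $t\mapsto1/(qt)$ makes sense. *)

(* Defs.v *)
From HB Require Import structures.
From mathcomp Require Import all_boot all_order all_algebra.
From mathcomp Require Import all_field.
From mathcomp Require Import all_classical.

Set Implicit Arguments.
Unset Strict Implicit.
Unset Printing Implicit Defensive.

Import GRing.Theory.

Local Open Scope classical_set_scope.
Local Open Scope ring_scope.

Record fps (A : Type) := Fps { fps_coef :> nat -> A }.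

Lemma fpsP (A : Type) (f g : fps A) : f =1 g -> f = g.
Proof. by case: f g => [f] [g] /= fg; congr Fps; apply/funext. Qed.

HB.instance Definition _ (A : Type) := gen_eqMixin (fps A).
HB.instance Definition _ (A : Type) := gen_choiceMixin (fps A).

Section FpsZmodule.
Variable A : zmodType.
Implicit Types f g h : fps A.

Definition fps_zero : fps A := Fps (fun=> 0).
Definition fps_opp f : fps A := Fps (fun n => - f n).
Definition fps_add f g : fps A := Fps (fun n => f n + g n).

Fact fps_addA : associative fps_add.
Proof. by move=> f g h; apply/fpsP => n /=; rewrite addrA. Qed.
Fact fps_addC : commutative fps_add.
Proof. by move=> f g; apply/fpsP => n /=; rewrite addrC. Qed.
Fact fps_add0 : left_id fps_zero fps_add.
Proof. by move=> f; apply/fpsP => n /=; rewrite add0r. Qed.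
Fact fps_addN : left_inverse fps_zero fps_opp fps_add.
Proof. by move=> f; apply/fpsP => n /=; rewrite addNr. Qed.

HB.instance Definition _ :=
  GRing.isZmodule.Build (fps A) fps_addA fps_addC fps_add0 fps_addN.

End FpsZmodule.

Section FpsRing.
Variable A : nzRingType.
Implicit Types f g h : fps A.

Definition fps_const (a : A) : fps A := Fps (fun n => if n is 0 then a else 0).
Definition fps_X : fps A := Fps (fun n => (n == 1)%:R).
Definition fps_mul f g : fps A :=
  Fps (fun n => \sum_(i < n.+1) f i * g (n - i)%N).
Definition fps_of_poly (p : {poly A}) : fps A := Fps (fun n => p`_n).
Definition fps_trunc N f : {poly A} := \poly_(i < N.+1) f i.

Lemma fps_mulE N n f g :
  (n <= N)%N -> fps_mul f g n = (fps_trunc N f * fps_trunc N g)`_n.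
Proof.
move=> nN /=; rewrite coefM; apply: eq_bigr => -[i /= ilt] _.
rewrite !coef_poly !ltnS (leq_trans (leq_subr _ _) nN).
by rewrite (leq_trans _ nN) // -ltnS.
Qed.

Fact fps_mulA : associative fps_mul.
Proof.
move=> f g h; apply/fpsP => n.
rewrite (@fps_mulE n) // (@fps_mulE n n (fps_mul f g)) //.
transitivity ((fps_trunc n f * fps_trunc n g * fps_trunc n h)`_n).
  rewrite -mulrA !coefM; apply: eq_bigr => -[i /= ilt] _; congr (_ * _).
  by rewrite coef_poly ltnS leq_subr (@fps_mulE n) // leq_subr.
rewrite [LHS]coefM [RHS]coefM; apply: eq_bigr => -[i /= ilt] _.
by congr (_ * _); rewrite [RHS]coef_poly ilt (@fps_mulE n).
Qed.

Fact fps_mul1l : left_id (fps_const 1) fps_mul.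
Proof.
move=> f; apply/fpsP => n /=; rewrite big_ord_recl subn0 mul1r big1 ?addr0 //.
by move=> i _; rewrite mul0r.
Qed.

Fact fps_mul1r : right_id (fps_const 1) fps_mul.
Proof.
move=> f; apply/fpsP => n /=; rewrite big_ord_recr /= subnn mulr1 big1 ?add0r //.
by move=> i _; case E: (n - i)%N (ltn_ord i) => [|m] /=;
  rewrite -subn_gt0 ?E // mulr0.
Qed.

Fact fps_mulDl : left_distributive fps_mul +%R.
Proof.
move=> f g h; apply/fpsP => n /=; rewrite -big_split.
by apply: eq_bigr => i _; rewrite mulrDl.
Qed.

Fact fps_mulDr : right_distributive fps_mul +%R.
Proof.
move=> f g h; apply/fpsP => n /=; rewrite -big_split.
by apply: eq_bigr => i _; rewrite mulrDr.
Qed.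

Fact fps_one_neq0 : fps_const 1 != 0.
Proof.
by apply/eqP => /(congr1 (fun f : fps A => f 0%N)) /= /eqP; rewrite oner_eq0.
Qed.

HB.instance Definition _ := GRing.Zmodule_isNzRing.Build (fps A)
  fps_mulA fps_mul1l fps_mul1r fps_mulDl fps_mulDr fps_one_neq0.

Definition fps_scale (a : A) f : fps A := Fps (fun n => a * f n).

Fact fps_scaleA a b f : fps_scale a (fps_scale b f) = fps_scale (a * b) f.
Proof. by apply/fpsP => n /=; rewrite mulrA. Qed.
Fact fps_scale1 : left_id 1 fps_scale.
Proof. by move=> f; apply/fpsP => n /=; rewrite mul1r. Qed.
Fact fps_scaleDr : right_distributive fps_scale +%R.
Proof. by move=> a f g; apply/fpsP => n /=; rewrite mulrDr. Qed.
Fact fps_scaleDl f : {morph fps_scale^~ f : a b / a + b}.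
Proof. by move=> a b; apply/fpsP => n /=; rewrite mulrDl. Qed.

HB.instance Definition _ := GRing.Zmodule_isLmodule.Build A (fps A)
  fps_scaleA fps_scale1 fps_scaleDr fps_scaleDl.

End FpsRing.

Arguments fps_X {A}.

Section FpsComRing.
Variable A : comNzRingType.

Fact fps_mulC : commutative (@fps_mul A).
Proof. by move=> f g; apply/fpsP => n; rewrite !(@fps_mulE _ n) // mulrC. Qed.

HB.instance Definition _ :=
  GRing.PzRing_hasCommutativeMul.Build (fps A) fps_mulC.

End FpsComRing.

(* [A[[x, y]]] is rendered as [A[[x]][[y]]], and a polynomial in [x, y] as an
   element of [A[x][y]]: the inner variable is [x], the outer one is [y]. *)

Notation fps2 A := (fps (fps A)).

Section Bivariate.
Variable A : nzRingType.

Definition fps2_const (a : A) : fps2 A := fps_const (fps_const a).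
Definition fps2_x : fps2 A := fps_const fps_X.
Definition fps2_y : fps2 A := fps_X.
Definition fps2_of_poly (p : {poly {poly A}}) : fps2 A :=
  Fps (fun j => fps_of_poly p`_j).

End Bivariate.

Arguments fps2_x {A}.
Arguments fps2_y {A}.

Section CommutativeAlgebra.
Variable A : comPzRingType.

Definition invertible (a : A) : Prop := exists b, a * b = 1.

Definition irreducible_elt (a : A) : Prop :=
  [/\ a <> 0, ~ invertible a &
      forall b c, a = b * c -> invertible b \/ invertible c].

(* The unit ideal is an ideal here, unlike in [ring_quotient.idealr_closed]. *)
Definition is_ideal (I : set A) : Prop :=
  [/\ I 0, (forall u v, I u -> I v -> I (u + v)) &
      forall a u, I u -> I (a * u)].

Definition maximal_ideal (I : set A) : Prop :=
  [/\ is_ideal I, ~ I 1 &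
      forall J : set A, is_ideal J -> ~ J 1 -> I `<=` J -> J = I].

Definition ideal_mul (I J : set A) : set A :=
  [set x | exists n (u v : 'I_n -> A),
     (forall i, I (u i) /\ J (v i)) /\ x = \sum_(i < n) u i * v i].

Definition principal_ideal (a : A) : set A := [set x | exists b, x = a * b].

(* [a / s], with [s] a non-zero-divisor, is integral over [A]; the monic
   equation is multiplied by [s ^+ n]. *)
Definition integral_fraction (a s : A) : Prop :=
  exists n (c : 'I_n -> A),
    a ^+ n + \sum_(i < n) c i * a ^+ i * s ^+ (n - i) = 0.

End CommutativeAlgebra.

(* [mxpoly.integralOver] is restricted to [nzRingType], and the ring
   ['I_kappa -> _] is canonically only a [pzRingType]. *)
Definition integral_elt (A B : comPzRingType) (f : A -> B) (b : B) : Prop :=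
  exists n (c : 'I_n -> A), b ^+ n + \sum_(i < n) f (c i) * b ^+ i = 0.

(* [f] identifies [B] with the integral closure of [A] in its total ring of
   fractions. *)
Record is_normalization (A B : comPzRingType) (f : {rmorphism A -> B}) :
    Prop := IsNormalization {
  norm_inj : injective f;
  norm_lreg : forall s, GRing.lreg s -> GRing.lreg (f s);
  norm_fraction : forall b, exists s a, GRing.lreg s /\ f s * b = f a;
  norm_integral : forall b, integral_elt f b;
  norm_closed : forall a s, GRing.lreg s -> integral_fraction a s ->
    exists b, f s * b = f a
}.

Section QuotientDimension.
Variables (F : fieldType) (V : lmodType F).

(* For subspaces [W] and [U]: some [n] vectors of [U] induce a basis of the
   quotient of [U] by [W]. *)
Definition has_quot_dim (U W : set V) (n : nat) : Prop :=
  exists v : 'I_n -> V,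
    [/\ forall i, U (v i),
        forall u, U u -> exists c : 'I_n -> F, W (u - \sum_(i < n) c i *: v i) &
        forall c : 'I_n -> F, W (\sum_(i < n) c i *: v i) -> forall i, c i = 0].

(* 0 if the quotient is infinite-dimensional. *)
Definition quot_dim (U W : set V) : nat := xget 0%N (has_quot_dim U W).

End QuotientDimension.

(* In [{poly rat}] the variable is [a]; in [fps {poly rat}] and
   [{poly {poly rat}}] the outer variable is [t]. *)

Section Zeta.
Variables (F : finFieldType) (R : comAlgType F) (m : set R).

Definition ideal_rank (M : set R) : nat := quot_dim M (ideal_mul m M).

Definition ideals_of_degree (n : nat) : set (set R) :=
  [set M | is_ideal M /\ has_quot_dim setT M n].

Definition rank_weight (r : nat) : {poly rat} :=
  \prod_(1 <= j < r) (1 + (#|F| ^ j)%:R *: 'X).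

(* [\sum_(M \in _)] is a sum of finite support: it is [0] over an infinite
   set of nonzero terms. When [R] is a quotient of [fps2 F] and [m] its
   maximal ideal, there are finitely many ideals of degree [n], since they
   contain [m ^ n]. *)
Definition Z_series : fps {poly rat} :=
  Fps (fun n => \sum_(M \in ideals_of_degree n) rank_weight (ideal_rank M)).

Definition L_series (kappa : nat) : fps {poly rat} :=
  (1 - fps_X) ^+ kappa * Z_series.

End Zeta.

Notation ratfun := {fraction {poly {poly rat}}}.

Definition ratfun_t : ratfun := tofrac 'X.

Definition subst_t (L : {poly {poly rat}}) (u : ratfun) : ratfun :=
  (map_poly (fun c : {poly rat} => tofrac c%:P) L).[u].

(* Main.v *)
From HB Require Import structures.
Require Import Defs.
From mathcomp Require Import all_boot all_order all_algebra all_field.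
From mathcomp Require Import all_classical.
From mathcomp Require Import zify ring.

Set Implicit Arguments.
Unset Strict Implicit.
Unset Printing Implicit Defensive.

Import GRing.Theory Num.Theory.

Local Open Scope classical_set_scope.
Local Open Scope ring_scope.

(** Put O for the product of the branch rings F[[z_i]] and view R inside O, where it has
    codimension delta.  A fractional ideal is uniquely z^n M, where n is an exponent vector
    and M is a normalized lattice: an R-submodule of O which contains, for every branch, an
    element that is a unit on that branch.  Normalized lattices contain the conductor z^c O,
    hence are finite in number, and z^n M is an ideal of R exactly when z^n lies in the dual
    M* = (R : M).  So the zeta function is the sum over the normalized M of
    w(rk M) t^[R:M] times the sum of t^|n| over the n such that z^n lies in M*, where w is
    the weight depending on the variable a.

    Multiplication by a unit of O permutes the normalized lattices and keeps the rank and the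
    codimension, so z^n may be replaced by z^n u and averaged over the units u
    ([average_units]).  By inclusion-exclusion over the branches, the proportion of units u
    with z^n u in M* is an alternating sum of volumes q^-codim of the preimages of M* under
    z^n, and these depend on min(n, c) only.  Therefore (1 - t)^kappa times the inner sum is a
    polynomial ([box_sum]): the sum over 0 <= n <= c of the volume at n times a product of
    one-variable polynomials theta_{c_i}(n_i).  This is a local zeta integral in the style of
    Tate.  Its functional equation combines the symmetry of theta under t -> 1/(qt),
    n_i -> c_i - n_i ([theta_reflect]) with the duality of volumes ([colon_cod_dual]); it
    exchanges M* and M.  The map which sends M to the normalized lattice proportional to M*
    is an involution ([normalized_dual_bij]), so summing over M gives the functional equation for
    every weight that takes the same value on M and on M*.

    That the weight depends on rk M only is enough because of two properties of plane curve
    singularities, both consequences of the Koszul complex of the generators x, y of the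
    maximal ideal m.  Its Euler characteristic on a lattice N vanishes, that is
    codim mN - codim N = codim N - codim (N : m) ([koszul_cod]).
    For N = R this says that (R : m) / R is a line; counting along a chain of submodules
    then yields codim M + codim M* = |c| = 2 delta and M** = M ([cod_dual], [dualK]).
    For general N it yields rk M* = rk M, because the dual of m M* is (M : m) ([rk_dual0]). *)

(** * Dimensions of quotient spaces *)

Section QuotDim.
Variables (F : fieldType).

Definition subspace (V : lmodType F) (A : set V) : Prop :=
  [/\ A 0, (forall u v, A u -> A v -> A (u + v)) &
      forall c u, A u -> A (c *: u)].

Section SubspaceTheory.
Variables (V : lmodType F) (A : set V).
Hypothesis sA : subspace A.

Lemma subspace0 : A 0. Proof. by case: sA. Qed.
Lemma subspaceD u v : A u -> A v -> A (u + v). Proof. by case: sA => _ + _; apply. Qed.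
Lemma subspaceZ c u : A u -> A (c *: u). Proof. by case: sA => _ _; apply. Qed.
Lemma subspaceN u : A u -> A (- u).
Proof. by move=> Au; rewrite -scaleN1r; apply: subspaceZ. Qed.
Lemma subspaceB u v : A u -> A v -> A (u - v).
Proof. by move=> Au Av; apply: subspaceD => //; apply: subspaceN. Qed.
Lemma subspace_sum I (r : seq I) (P : pred I) (f : I -> V) :
  (forall i, P i -> A (f i)) -> A (\sum_(i <- r | P i) f i).
Proof.
move=> h; apply: (big_ind A) => //; first exact: subspace0.
exact: subspaceD.
Qed.
Lemma subspaceBr u v : A (u - v) -> A v -> A u.
Proof. by move=> h hv; rewrite -(subrK v u); apply: subspaceD. Qed.
Lemma subspaceBl u v : A (u - v) -> A u -> A v.
Proof.
by move=> h hu; rewrite -(subKr u v); apply: subspaceB.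
Qed.

End SubspaceTheory.

Lemma subspaceT (V : lmodType F) : subspace [set: V].
Proof. by split. Qed.

Lemma subspaceI (V : lmodType F) (A B : set V) :
  subspace A -> subspace B -> subspace (A `&` B).
Proof.
move=> sA sB; split; first by split; apply: subspace0.
  by move=> u v [? ?] [? ?]; split; apply: subspaceD.
by move=> c u [? ?]; split; apply: subspaceZ.
Qed.

Definition sum_set (V : lmodType F) (A B : set V) : set V :=
  [set u | exists a b, [/\ A a, B b & u = a + b]].

Lemma subspace_sumset (V : lmodType F) (A B : set V) :
  subspace A -> subspace B -> subspace (sum_set A B).
Proof.
move=> sA sB; split.
- by exists 0, 0; rewrite addr0; split => //; apply: subspace0.
- move=> _ _ [a [b [Aa Bb ->]]] [a' [b' [Aa' Bb' ->]]].
  by exists (a + a'), (b + b'); rewrite addrACA; split => //; apply: subspaceD.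
- move=> c _ [a [b [Aa Bb ->]]]; exists (c *: a), (c *: b).
  by rewrite scalerDr; split => //; apply: subspaceZ.
Qed.

Lemma subspace_preim (V V' : lmodType F) (f : {linear V -> V'}) (A : set V') :
  subspace A -> subspace (f @^-1` A).
Proof.
move=> sA; split; rewrite /preimage /=.
- by rewrite linear0; apply: subspace0.
- by move=> u v Au Av; rewrite linearD; apply: subspaceD.
- by move=> c u Au; rewrite linearZ; apply: subspaceZ.
Qed.

Lemma subspace_im (V V' : lmodType F) (f : {linear V -> V'}) (A : set V) :
  subspace A -> subspace (f @` A).
Proof.
move=> sA; split.
- by exists 0; [apply: subspace0 | rewrite linear0].
- move=> _ _ [u Au <-] [v Av <-]; exists (u + v); last by rewrite linearD.
  exact: subspaceD.
- by move=> c _ [u Au <-]; exists (c *: u); [apply: subspaceZ | rewrite linearZ].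
Qed.

Section Comb.
Variables (V : lmodType F) (n : nat) (v : 'I_n -> V).
Definition comb (c : 'rV[F]_n) : V := \sum_(i < n) c 0 i *: v i.
Lemma comb_is_linear : linear comb.
Proof.
move=> a c d; rewrite /comb scaler_sumr -big_split; apply: eq_bigr => i _.
by rewrite !mxE scalerDl scalerA.
Qed.
HB.instance Definition _ := GRing.isLinear.Build F 'rV[F]_n V _ comb comb_is_linear.
End Comb.

Lemma comb_mul (V : lmodType F) n p (v : 'I_n -> V) (A : 'M[F]_(p, n)) c :
  comb (fun i => comb v (row i A)) c = comb v (c *m A).
Proof.
rewrite /comb; under eq_bigr do rewrite scaler_sumr; rewrite exchange_big /=.
apply: eq_bigr => j _; rewrite !mxE scaler_suml; apply: eq_bigr => i _.
by rewrite scalerA !mxE.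
Qed.

Lemma has_quot_dimP (V : lmodType F) (U W : set V) n :
  has_quot_dim U W n <-> exists v : 'I_n -> V,
    [/\ forall i, U (v i),
        forall u, U u -> exists c, W (u - comb v c) &
        forall c, W (comb v c) -> c = 0].
Proof.
split=> -[v [Uv sp ind]]; exists v; split=> //.
- move=> u /sp[c Wc]; exists (\row_i c i); rewrite /comb.
  by under eq_bigr do rewrite mxE.
- by move=> c /ind c0; apply/rowP => i; rewrite c0 mxE.
- by move=> u /sp[c Wc]; exists (fun i => c 0 i).
- move=> c h; have := ind (\row_i c i); rewrite /comb.
  under eq_bigr do rewrite mxE.
  by move=> /(_ h) /rowP c0 i; have := c0 i; rewrite !mxE.
Qed.

(** More vectors than the dimension have a relation: a nonzero row of the kernel of the
    matrix of their coordinates. *)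
Lemma quot_dim_indep (V : lmodType F) (U W : set V) m n (v : 'I_m -> V) : subspace W ->
  (forall i, U (v i)) -> (forall c, W (comb v c) -> c = 0) ->
  has_quot_dim U W n -> (m <= n)%N.
Proof.
move=> sW Uv vi /has_quot_dimP[w [_ wsp _]].
have /choice[a Ha] : forall i, exists c, W (v i - comb w c).
  by move=> i; apply: wsp.
pose A := \matrix_(i < m) a i.
rewrite leqNgt; apply/negP => ltnm.
have kA : kermx A != 0.
  rewrite -mxrank_eq0 mxrank_ker -lt0n subn_gt0.
  exact: leq_ltn_trans (rank_leq_col A) ltnm.
have [i ri] : exists i, row i (kermx A) != 0.
  apply/existsP; apply: contraNT kA; rewrite negb_exists => /forallP h.
  by apply/eqP/row_matrixP => i; rewrite row0; apply/eqP; rewrite -[_ == _]negbK; apply: h.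
case/eqP: ri; apply: vi; set c := row i _.
have cA : c *m A = 0 by apply: (sub_kermxP _); apply: row_sub.
have w0 : comb w (c *m A) = 0 by rewrite cA linear0.
rewrite -[comb v c]subr0 -w0 -comb_mul /comb -sumrB.
apply: subspace_sum => // j _; rewrite -scalerBr; apply: subspaceZ => //.
by rewrite rowK; apply: Ha.
Qed.

Lemma quot_dim_le (V : lmodType F) (U W : set V) m n : subspace W ->
  has_quot_dim U W m -> has_quot_dim U W n -> (m <= n)%N.
Proof. by move=> sW /has_quot_dimP[v [Uv _ vi]]; apply: quot_dim_indep. Qed.

Lemma quot_dim_uniq (V : lmodType F) (U W : set V) m n : subspace W ->
  has_quot_dim U W m -> has_quot_dim U W n -> m = n.
Proof.
move=> sW h1 h2; apply/eqP; rewrite eqn_leq.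
by rewrite (quot_dim_le sW h1 h2) (quot_dim_le sW h2 h1).
Qed.

Lemma quot_dim_eq (V : lmodType F) (U W : set V) n : subspace W ->
  has_quot_dim U W n -> quot_dim U W = n.
Proof.
move=> sW h; apply: xget_unique => // m hm; exact: quot_dim_uniq sW hm h.
Qed.

Lemma subspace_mx n (S : set 'rV[F]_n) : subspace S ->
  exists A : 'M[F]_n, forall c, S c <-> (c <= A)%MS.
Proof.
move=> sS.
pose P r := `[< exists A : 'M[F]_n, (forall c, (c <= A)%MS -> S c) /\ \rank A = r >].
have exP : exists r, P r.
  exists 0%N; apply/asboolP; exists 0; rewrite mxrank0; split=> // c.
  by rewrite submx0 => /eqP->; apply: subspace0.
have bP r : P r -> (r <= n)%N by move=> /asboolP[A [_ <-]]; apply: rank_leq_row.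
case: (ex_maxnP exP bP) => r /asboolP[A [SA rA]] rmax.
exists A => c; split=> [Sc|]; last exact: SA.
have /rmax : P (\rank (A + c)%MS).
  apply/asboolP; exists (A + c)%MS; split=> // d /sub_addsmxP[[d1 d2] /= ->].
  apply: subspaceD => //; first by apply: SA; apply: submxMl.
  by rewrite [d2]mx11_scalar mul_scalar_mx; apply: subspaceZ.
rewrite -rA => le.
have/eqmxP e : (A == A + c)%MS.
  by rewrite -(geq_leqif (mxrank_leqif_eq (addsmxSl A c))).
by rewrite e addsmxSr.
Qed.

(** The coordinates of the vectors of B form a subspace of F^n, that is, the row space of a
    matrix A; bases of B/W and U/B come from row bases of A and of a complement of A. *)
Lemma quot_dim_between (V : lmodType F) (U B W : set V) n :
  subspace U -> subspace B -> subspace W -> W `<=` B -> B `<=` U ->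
  has_quot_dim U W n ->
  exists a b, [/\ has_quot_dim U B a, has_quot_dim B W b & n = (a + b)%N].
Proof.
move=> sU sB sW WB BU /has_quot_dimP[v [Uv sp ind]].
have [A HA] := subspace_mx (subspace_preim (comb v) sB).
exists (\rank A^C%MS), (\rank A); split.
- apply/has_quot_dimP; exists (fun i => comb v (row i (row_base A^C%MS))); split.
  + by move=> i; apply: subspace_sum => // j _; apply: subspaceZ.
  + move=> u /sp[c Wc].
    have : (c <= A + A^C%MS)%MS by apply: submx_full; apply: addsmx_compl_full.
    case/sub_addsmxP => -[d1 d2] /= ec.
    have : (d2 *m A^C%MS <= row_base A^C%MS)%MS by rewrite eq_row_base submxMl.
    case/submxP => d ed; exists d; rewrite comb_mul -ed.
    have /WB := Wc; rewrite ec linearD opprD addrA => h.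
    rewrite -(subrK (comb v (d1 *m A)) u) addrAC; apply: subspaceD => //.
    by apply/HA; apply: submxMl.
  + move=> c; rewrite comb_mul => /HA h.
    have : (c *m row_base A^C%MS <= A :&: A^C%MS)%MS.
      by rewrite sub_capmx h -(eq_row_base A^C%MS) submxMl.
    rewrite capmx_compl submx0 => /eqP h0.
    by apply: (row_free_inj (row_base_free A^C%MS)); rewrite h0 mul0mx.
- apply/has_quot_dimP; exists (fun i => comb v (row i (row_base A))); split.
  + by move=> i; apply/HA; rewrite -(eq_row_base A); apply: row_sub.
  + move=> u Bu; have [c Wc] := sp _ (BU _ Bu).
    have /HA : B (comb v c) by apply: (subspaceBl sB (WB _ Wc)).
    rewrite -(eq_row_base A) => /submxP[d ed]; exists d.
    by rewrite comb_mul -ed.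
  + move=> c; rewrite comb_mul => /ind h0.
    by apply: (row_free_inj (row_base_free A)); rewrite h0 mul0mx.
- by rewrite mxrank_compl subnK // rank_leq_row.
Qed.

Lemma quot_dim_add (V : lmodType F) (U B W : set V) a b :
  subspace B -> subspace W -> W `<=` B -> B `<=` U ->
  has_quot_dim U B a -> has_quot_dim B W b -> has_quot_dim U W (a + b).
Proof.
move=> sB sW WB BU /has_quot_dimP[v [Uv vsp vi]] /has_quot_dimP[w [Bw wsp wi]].
pose x (i : 'I_(a + b)) := match fintype.split i with inl j => v j | inr j => w j end.
have xE c : comb x c = comb v (lsubmx c) + comb w (rsubmx c).
  rewrite /comb big_split_ord; congr (_ + _); apply: eq_bigr => i _.
    by rewrite mxE /x (unsplitK (inl i)).
  by rewrite mxE /x (unsplitK (inr i)).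
apply/has_quot_dimP; exists x; split.
- by move=> i; rewrite /x; case: splitP => j _ //; apply: BU.
- move=> u /vsp[c /wsp[d Wd]]; exists (row_mx c d).
  by rewrite xE row_mxKl row_mxKr opprD addrA.
- move=> c; rewrite xE => Wc.
  have c1 : lsubmx c = 0.
    apply: vi; rewrite -[comb v _](addrK (comb w (rsubmx c))).
    apply: subspaceB => //; first exact: WB.
    by apply: subspace_sum => // i _; apply: subspaceZ.
  have c2 : rsubmx c = 0 by apply: wi; rewrite c1 linear0 add0r in Wc.
  by rewrite -[c]hsubmxK c1 c2 row_mx0.
Qed.

(** The last three hypotheses say that f induces an isomorphism from U/W onto U'/W'.
    Second isomorphism theorems are the instances where f is the identity. *)
Lemma quot_dim_iso (V V' : lmodType F) (f : {linear V -> V'})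
    (U W : set V) (U' W' : set V') n : subspace U -> subspace W' ->
  (forall u, U u -> U' (f u)) ->
  (forall u', U' u' -> exists2 u, U u & W' (u' - f u)) ->
  (forall u, U u -> W u <-> W' (f u)) ->
  has_quot_dim U W n <-> has_quot_dim U' W' n.
Proof.
move=> sU sW' fU fsurj fW.
have fc m (v : 'I_m -> V) c : f (comb v c) = comb (f \o v) c.
  by rewrite /comb linear_sum; apply: eq_bigr => i _; rewrite linearZ.
have Uc m (v : 'I_m -> V) c : (forall i, U (v i)) -> U (comb v c).
  by move=> Uv; apply: subspace_sum => // i _; apply: subspaceZ.
split=> /has_quot_dimP[v [Uv sp ind]]; apply/has_quot_dimP.
- exists (f \o v); split.
  + by move=> i; apply: fU; apply: Uv.
  + move=> u' /fsurj[u /[dup] Uu /sp[c Wc] W'u]; exists c.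
    rewrite -fc -(subrK (f u) u') -addrA -linearB; apply: subspaceD => //.
    by apply/fW => //; apply: subspaceB => //; apply: Uc.
  + by move=> c; rewrite -fc => /fW h; apply: ind; apply: h; apply: Uc.
- have /choice[w Hw] : forall i, exists u, U u /\ W' (v i - f u).
    by move=> i; have [u Uu Wu] := fsurj _ (Uv i); exists u.
  have Uw i : U (w i) by case: (Hw i).
  have Wc c : W' (comb v c - f (comb w c)).
    rewrite fc /comb -sumrB; apply: subspace_sum => // i _.
    by rewrite -scalerBr; apply: subspaceZ => //; case: (Hw i).
  exists w; split=> //.
  + move=> u /[dup] Uu /fU/sp[c h]; exists c; apply/fW.
      by apply: subspaceB => //; apply: Uc.
    by rewrite linearB /= -(subrK (comb v c) (f u)) -addrA; apply: subspaceD.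
  + move=> c /(fW _ (Uc _ _ _ Uw)) h; apply: ind.
    by apply: (subspaceBr sW' (Wc c)); apply: h.
Qed.

(** Here f only induces an injection of U/W into U'/W'. *)
Lemma quot_dim_preim (V V' : lmodType F) (f : {linear V -> V'})
    (U W : set V) (U' W' : set V') n :
  subspace U -> subspace U' -> subspace W' -> W' `<=` U' ->
  (forall u, U u -> U' (f u)) -> (forall u, U u -> W u <-> W' (f u)) ->
  has_quot_dim U' W' n -> exists2 m, (m <= n)%N & has_quot_dim U W m.
Proof.
move=> sU sU' sW' WU' fU fW h.
have sI : subspace (sum_set (f @` U) W').
  by apply: subspace_sumset => //; apply: subspace_im.
have [| |a [b [_ hb ->]]] := quot_dim_between sU' sI sW' _ _ h.
- move=> u Wu; exists 0, u; rewrite add0r; split=> //.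
  by exists 0; [apply: subspace0 | rewrite linear0].
- by move=> _ [_ [w [[u Uu <-] Ww ->]]]; apply: subspaceD; [|apply: fU|apply: WU'].
exists b; first exact: leq_addl.
have su u : U u -> sum_set (f @` U) W' (f u).
  by move=> Uu; exists (f u), 0; rewrite addr0; split=> //; apply: subspace0.
have ss u' : sum_set (f @` U) W' u' -> exists2 u, U u & W' (u' - f u).
  by move=> [_ [w [[u Uu <-] Ww ->]]]; exists u; rewrite // addrAC subrr add0r.
exact: (iffRL (quot_dim_iso _ sU sW' su ss fW)) hb.
Qed.

Lemma quot_dim0 (V : lmodType F) (U W : set V) : subspace U ->
  has_quot_dim U W 0 <-> U `<=` W.
Proof.
move=> sU; split.
  by case=> v [_ sp _] u /sp[c]; rewrite big_ord0 subr0.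
move=> UW; exists (fun=> 0); split=> [[]//|u /UW Wu|c _ []//].
by exists (fun=> 0); rewrite big_ord0 subr0.
Qed.

End QuotDim.

(** * Power series in one variable over a field *)

Section FpsInverse.
Variable F : fieldType.
Implicit Types f g h : fps F.

Lemma fps_sumE I (r : seq I) (P : pred I) (f : I -> fps F) n :
  (\sum_(i <- r | P i) f i) n = \sum_(i <- r | P i) f i n.
Proof. by apply: (big_morph (fun f : fps F => f n)). Qed.

Lemma fps_pow_low h n m : h 0%N = 0 -> (m < n)%N -> (h ^+ n) m = 0.
Proof.
move=> h0; elim: n m => // n IH m mn; rewrite exprS.
rewrite [LHS]/= big_ord_recl h0 mul0r add0r big1 // => i _.
rewrite [X in _ * X]IH ?mulr0 //= /bump /= add1n.
by rewrite (leq_trans (n := m)) // ltn_subrL //=; case: m mn i => [|m] // _ [].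
Qed.

(** The coefficient of degree n of the geometric series involves the powers of h up to n
    only, so the finite geometric sum identity applies degree by degree. *)
Lemma fps_geom h : h 0%N = 0 -> exists g, (1 - h) * g = 1.
Proof.
move=> h0; exists (Fps (fun n => (\sum_(i < n.+1) h ^+ i) n)); apply/fpsP => n.
have -> : ((1 - h) * Fps (fun n => (\sum_(i < n.+1) h ^+ i) n)) n =
          ((1 - h) * \sum_(i < n.+1) h ^+ i) n.
  apply: eq_bigr => j _; congr (_ * _) => /=; rewrite !fps_sumE.
  rewrite (big_ord_widen n.+1 (fun i => (h ^+ i) (n - j)%N)) ?ltnS ?leq_subr //.
  rewrite big_mkcond /=; apply: eq_bigr => i _; rewrite ltnS.
  by case: ifPn => //; rewrite -ltnNge => /(fps_pow_low h0).
rewrite -opprB mulNr -subrX1 opprB.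
by rewrite [LHS]/= fps_pow_low // subr0.
Qed.

Lemma fps_unit f : f 0%N != 0 -> exists g, f * g = 1.
Proof.
move=> f0; pose c := f 0%N.
have [|g Hg] := @fps_geom (1 - c^-1 *: f).
  by rewrite /= mulVf // subrr.
exists (c^-1 *: g); rewrite -Hg subKr; apply/fpsP => n /=.
by apply: eq_bigr => i _; rewrite mulrCA mulrA.
Qed.

Lemma fps_val f : f <> 0 -> exists2 n, f n != 0 & forall j, (j < n)%N -> f j = 0.
Proof.
move=> fn0; have ex : exists n, f n != 0.
  apply/not_existsP => h; apply: fn0; apply/fpsP => n /=.
  by apply/eqP; rewrite -[_ == _]negbK; apply/negP/h.
case: (ex_minnP ex) => n fn nmin; exists n => // j jn.
by apply/eqP; apply: contraLR jn => /nmin; rewrite -leqNgt.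
Qed.

End FpsInverse.

(** * Open subspaces of a product of power series rings *)

Section Branches.
Variables (F : fieldType) (k : nat).
Notation O := ('I_k -> fps F).
Notation mi := ('I_k -> nat).
Implicit Types (u v : O) (n m : mi) (A B : set O).

Lemma OP u v : (forall i j, u i j = v i j) -> u = v.
Proof. by move=> h; apply/funext => i; apply/fpsP => j. Qed.

Definition mulO u : O -> O := fun v => u * v.
Lemma mulO_is_linear u : linear (mulO u).
Proof.
move=> c v w; rewrite /mulO mulrDr; congr (_ + _); apply: OP => i j /=.
by rewrite [RHS]mulr_sumr; apply: eq_bigr => l _; rewrite mulrCA.
Qed.
HB.instance Definition _ u :=
  GRing.isLinear.Build F O O _ (mulO u) (mulO_is_linear u).

Lemma scaleOM c u v : c *: (u * v) = u * (c *: v).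
Proof. by rewrite -[RHS]/(mulO u _) linearZ. Qed.

(** The O-ideal z^n O; these ideals are a basis of neighbourhoods of 0 in O. *)
Definition zO n : set O := [set u | forall i j, (j < n i)%N -> u i j = 0].
Definition zpow n : O := fun i => Fps (fun j => (j == n i)%:R).
(** Division by z^n, which is exact on z^n O only. *)
Definition zdiv n u : O := fun i => Fps (fun j => u i (j + n i)%N).
Definition wt n := (\sum_i n i)%N.

Lemma zpowE n u i j : (zpow n * u) i j = if (j < n i)%N then 0 else u i (j - n i)%N.
Proof.
rewrite [LHS]/=; case: ltnP => nj.
  by rewrite big1 // => -[l /= lj] _; rewrite ltn_eqF ?mul0r //; exact: leq_ltn_trans nj.
rewrite (bigD1 (Ordinal (n:=j.+1) (m:=n i) _)) //= eqxx mul1r big1 ?addr0 // => l.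
by rewrite -val_eqE /= => /negPf->; rewrite mul0r.
Qed.

Lemma zO_subspace n : subspace (zO n).
Proof.
split=> [//|u v hu hv i j ji|c u hu i j ji] /=; rewrite ?hu ?hv ?addr0 ?mulr0 //.
Qed.

Lemma zO_mul n m u v : zO n u -> zO m v -> zO (fun i => (n i + m i)%N) (u * v).
Proof.
move=> hu hv i j ji /=; apply: big1 => -[l /= lj] _.
case: (ltnP l (n i)) => ln; first by rewrite hu ?mul0r.
by rewrite hv ?mulr0 // ltn_subLR // (leq_trans ji) ?leq_add2r.
Qed.

Lemma zO_mulr n u v : zO n v -> zO n (u * v).
Proof. by move=> hv; apply: (@zO_mul (fun=> 0%N) n u v). Qed.

Lemma zO_le n m : (forall i, n i <= m i)%N -> zO m `<=` zO n.
Proof. by move=> nm u hu i j ji; apply: hu; apply: leq_trans (nm i). Qed.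

Lemma zO_zpow n u : zO n (zpow n * u).
Proof. by move=> i j ji; rewrite zpowE ji. Qed.

Lemma zpowK n u : zdiv n (zpow n * u) = u.
Proof.
apply: OP => i j; rewrite -[LHS]/((zpow n * u) i (j + n i)%N) zpowE.
by rewrite ltnNge leq_addl /= addnK.
Qed.

Lemma zdivK n u : zO n u -> zpow n * zdiv n u = u.
Proof. by move=> hu; apply: OP => i j; rewrite zpowE; case: ltnP => [/hu->|/subnK/= ->]. Qed.

Lemma zpowI n : injective (fun u => zpow n * u).
Proof. by move=> u v /(congr1 (zdiv n)); rewrite !zpowK. Qed.

Lemma zpowD n m : zpow (fun i => (n i + m i)%N) = zpow n * zpow m.
Proof.
apply: OP => i j; rewrite zpowE /=; case: ltnP => jn.
  by rewrite ltn_eqF // ltn_addr.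
by rewrite -{1}(subnKC jn) eqn_add2l.
Qed.

Lemma zpow0 : zpow (fun=> 0%N) = 1.
Proof. by apply: OP => i [|j]. Qed.

Lemma O_unit u : (forall i, u i 0%N != 0) -> exists v, u * v = 1.
Proof.
by move=> h; have /choice[v Hv] i := fps_unit (h i); exists v; apply/funext => i; apply: Hv.
Qed.

Lemma mulO_0 u v i : (u * v) i 0%N = u i 0%N * v i 0%N.
Proof. by rewrite [LHS]/= big_ord_recl big_ord0 addr0 subnn. Qed.

Lemma O_unit_inv u v : u * v = 1 -> forall i, u i 0%N != 0.
Proof.
move=> e i; apply/eqP => u0; have := mulO_0 u v i; rewrite e u0 mul0r /= => /eqP.
by rewrite oner_eq0.
Qed.

(** An element that vanishes on no branch is a unit times z^n. *)
Lemma O_factor u : (forall i, u i <> 0) ->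
  exists n v, (forall i, v i 0%N != 0) /\ u = zpow n * v.
Proof.
move=> h; have /choice[n Hn] : forall i, exists d : nat,
    u i d != 0 /\ forall j, (j < d)%N -> u i j = 0.
  by move=> i; have [d ? ?] := fps_val (h i); exists d.
exists n, (zdiv n u); rewrite zdivK; last by move=> i; case: (Hn i).
by split=> // i /=; case: (Hn i).
Qed.

Definition mono (i : 'I_k) j : O := fun i' => Fps (fun j' => ((i' == i) && (j' == j))%:R).
Lemma mono_mulE u i d j : (mono i d * u) j = if j == i then (zpow (fun=> d) * u) j else 0.
Proof.
apply/fpsP => l; case: eqP => [->|ne]; rewrite [LHS]/=.
  by apply: eq_bigr => a _; rewrite eqxx.
by rewrite big1 // => a _; rewrite (introF eqP ne) mul0r.
Qed.

Definition incr n (i : 'I_k) : mi := fun i' => (n i' + (i' == i))%N.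

Lemma quot_dim_incr n i : has_quot_dim (zO n) (zO (incr n i)) 1.
Proof.
exists (fun=> mono i (n i)); split.
- by move=> _ i' j ji /=; case: eqP => //= e; rewrite e in ji; rewrite ltn_eqF.
- move=> u hu; exists (fun=> u i (n i)); rewrite big_ord1 => i' j /=; rewrite /incr.
  case: eqP => [->|_] /=; last by rewrite addn0 mulr0 subr0; apply: hu.
  rewrite addn1 ltnS leq_eqVlt => /orP[/eqP->|/[dup] jn /hu->].
    by rewrite eqxx mulr1 subrr.
  by rewrite ltn_eqF // mulr0 subr0.
- move=> c; rewrite big_ord1 => /(_ i (n i)); rewrite /incr /= eqxx addn1 ltnSn.
  by rewrite eqxx mulr1 => /(_ isT) c0 i'; rewrite ord1.
Qed.

Lemma wt_incr n i : wt (incr n i) = (wt n).+1.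
Proof.
rewrite /wt /incr big_split /= -addn1; congr (_ + _)%N.
by rewrite (bigD1 i) //= eqxx big1 // => j /negPf->.
Qed.

Lemma wt0P n : wt n = 0%N -> n = fun=> 0%N.
Proof.
move=> /eqP; rewrite sum_nat_eq0 => /forallP h; apply/funext => i.
by apply/eqP; apply: h.
Qed.

Lemma quot_dim_zO n : has_quot_dim setT (zO n) (wt n).
Proof.
move Ew: (wt n) => w; elim: w n Ew => [|w IH] n Ew.
  apply/(@quot_dim0 _ _ _ _ (subspaceT O)) => u _ i j; by rewrite (wt0P Ew).
have [i ni] : exists i, (0 < n i)%N.
  apply/existsP; move: Ew; apply: contra_eqT; rewrite negb_exists => /forallP h.
  by rewrite /wt big1 // => i _; apply/eqP; move: (h i); rewrite lt0n negbK.
pose n' : mi := fun i' => (n i' - (i' == i))%N.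
have en : n = incr n' i.
  apply/funext => i'; rewrite /incr /n'; case: eqP => [->|_]; last by rewrite subn0 addn0.
  by rewrite subnK.
have w' : wt n' = w by apply: succn_inj; rewrite -(wt_incr _ i) -en.
rewrite -[w.+1]addn1; apply: (quot_dim_add (zO_subspace n') (zO_subspace n)) => //.
- by apply: zO_le => i'; rewrite leq_subr.
- exact: IH.
- by rewrite {1}en; apply: quot_dim_incr.
Qed.

Definition open A := subspace A /\ exists n, zO n `<=` A.

Definition cod A := quot_dim setT A.

Lemma open_zO n : open (zO n).
Proof. by split; [exact: zO_subspace | exists n]. Qed.

Lemma open_le A B : open A -> subspace B -> A `<=` B -> open B.
Proof. by move=> [_ [n hn]] sB AB; split=> //; exists n; apply: subset_trans AB. Qed.

Lemma openI A B : open A -> open B -> open (A `&` B).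
Proof.
move=> [sA [n hn]] [sB [m hm]]; split; first exact: subspaceI.
exists (fun i => maxn (n i) (m i)) => u hu; split.
  by apply: hn; apply: zO_le hu => i; apply: leq_maxl.
by apply: hm; apply: zO_le hu => i; apply: leq_maxr.
Qed.

Lemma open_sum A B : open A -> subspace B -> open (sum_set A B).
Proof.
move=> oA sB; apply: (open_le oA); first by apply: subspace_sumset => //; case: oA.
by move=> u Au; exists u, 0; rewrite addr0; split => //; apply: subspace0.
Qed.

Lemma open_quot A : open A -> has_quot_dim setT A (cod A).
Proof.
move=> [sA [n hn]].
have [a [_ [h _ _]]] := quot_dim_between (subspaceT _) sA (zO_subspace n) hn
  (@subsetT _ _) (quot_dim_zO n).
by rewrite /cod (quot_dim_eq sA h).
Qed.

Lemma codE A d : subspace A -> has_quot_dim setT A d -> cod A = d.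
Proof. exact: quot_dim_eq. Qed.

Lemma cod_zO n : cod (zO n) = wt n.
Proof. by apply: codE (quot_dim_zO n); apply: zO_subspace. Qed.

Lemma cod_quot A B d : open A -> subspace B -> A `<=` B ->
  has_quot_dim B A d <-> cod A = (cod B + d)%N.
Proof.
move=> oA sB AB; have oB := open_le oA sB AB; have sA : subspace A by case: oA.
have [a [b [ha hb e]]] := quot_dim_between (subspaceT _) sB sA AB (@subsetT _ _) (open_quot oA).
have ea := codE sB ha; split=> [h|/eqP].
  by apply: codE => //; apply: quot_dim_add h => //; apply: open_quot.
by rewrite e ea eqn_add2l => /eqP <-.
Qed.

Lemma cod_le A B : open A -> subspace B -> A `<=` B -> (cod B <= cod A)%N.
Proof.
move=> oA sB AB; have oB := open_le oA sB AB; have sA : subspace A by case: oA.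
have [a [b [ha hb e]]] := quot_dim_between (subspaceT _) sB sA AB (@subsetT _ _) (open_quot oA).
by rewrite e (codE sB ha) leq_addr.
Qed.

Lemma quot_cod A B : open A -> subspace B -> A `<=` B ->
  has_quot_dim B A (cod A - cod B).
Proof.
by move=> oA sB AB; apply/cod_quot => //; rewrite subnKC //; apply: cod_le.
Qed.

Lemma cod_eq A B : open A -> subspace B -> A `<=` B -> cod A = cod B -> A = B.
Proof.
move=> oA sB AB e; apply/seteqP; split=> //; apply/(quot_dim0 _ sB).
by apply/cod_quot; rewrite // addn0.
Qed.

Lemma cod_modular A B : open A -> open B ->
  (cod (A `&` B) + cod (sum_set A B) = cod A + cod B)%N.
Proof.
move=> oA oB; have [sA _] := oA; have [sB _] := oB.
have oI := openI oA oB; have oS := open_sum oA sB; have [sS _] := oS.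
have h1 := quot_cod oI sA (@subIsetl _ _ _).
have BS : B `<=` sum_set A B.
  by move=> u Bu; exists 0, u; rewrite add0r; split=> //; apply: subspace0.
have h2 : has_quot_dim (sum_set A B) B (cod (A `&` B) - cod A).
  apply: (iffLR (@quot_dim_iso _ _ _ idfun _ _ _ _ _ sA sB _ _ _)) h1.
  - by move=> u Au; exists u, 0; rewrite addr0; split=> //; apply: subspace0.
  - by move=> _ [a [b [Aa Bb ->]]]; exists a => //=; rewrite addrAC subrr add0r.
  - by move=> u Au /=; split=> [[]|].
have := iffLR (cod_quot _ oB sS BS) h2.
have := cod_le oI sA (@subIsetl _ _ _).
by lia.
Qed.

Lemma open_sub A : open A -> subspace A. Proof. by case. Qed.

Lemma open_preim u A : open A -> open [set v | A (u * v)].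
Proof.
move=> [sA [n hn]]; split; first exact: (subspace_preim (mulO u) sA).
by exists n => v hv; apply: hn; apply: zO_mulr.
Qed.

(** Multiplication by z^n is an isomorphism of the set on the left onto the intersection
    of A with z^n O. *)
Lemma cod_preim_zpow n A : open A ->
  (cod [set v | A (zpow n * v)%R] + wt n = cod (A `&` zO n))%N.
Proof.
move=> oA; have oP := open_preim (zpow n) oA; have oI := openI oA (open_zO n).
apply/esym; rewrite addnC -cod_zO; apply/cod_quot => //; first exact: zO_subspace.
apply: (iffLR (@quot_dim_iso _ _ _ (mulO (zpow n)) _ _ _ _ _ (subspaceT _) _ _ _ _)) (open_quot oP).
- exact: open_sub oI.
- by move=> u _; apply: zO_zpow.
- move=> u hu; exists (zdiv n u) => //; rewrite /= /mulO zdivK // subrr.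
  exact: (subspace0 (open_sub oI)).
- by move=> u _; split=> [h|[]//]; split=> //; apply: zO_zpow.
Qed.

Definition zshift n A : set O := [set u | exists2 v, A v & u = zpow n * v].

Lemma zshift_preim n A : [set v | zshift n A (zpow n * v)] = A.
Proof.
by apply/seteqP; split=> v; [case=> w Aw /zpowI -> | move=> Av; exists v].
Qed.

Lemma zshift_sub n A : subspace A -> subspace (zshift n A).
Proof.
move=> sA; have -> : zshift n A = mulO (zpow n) @` A.
  by apply/seteqP; split=> u [v Av e]; exists v.
exact: subspace_im.
Qed.

Lemma open_zshift n A : open A -> open (zshift n A).
Proof.
move=> [sA [m hm]]; split; first exact: zshift_sub.
exists (fun i => (n i + m i)%N) => u hu; exists (zdiv n u); last first.
  by rewrite zdivK //; apply: zO_le hu => i; apply: leq_addr.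
by apply: hm => i j ji /=; apply: hu; rewrite addnC ltn_add2l.
Qed.

Lemma cod_zshift n A : open A -> cod (zshift n A) = (cod A + wt n)%N.
Proof.
move=> oA; have oZ := open_zshift n oA.
rewrite -{2}(zshift_preim n A) cod_preim_zpow //; congr cod.
by apply/seteqP; split=> [u h|u []//]; split=> //; case: h => v _ ->; apply: zO_zpow.
Qed.

Lemma zO_exp d u n : (forall i, u i 0%N = 0) -> (forall i, n i <= d)%N -> zO n (u ^+ d).
Proof.
move=> u0 nd; apply: (@zO_le n (fun=> d)) => // i j /= jd.
have -> : (u ^+ d) i = u i ^+ d by elim: (d) => // e IH; rewrite !exprS -IH.
exact: fps_pow_low.
Qed.

End Branches.

(** * The Koszul complex of two generators *)

Section Koszul.
Variables (F : fieldType) (k : nat).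
Notation O := ('I_k -> fps F).
Notation mi := ('I_k -> nat).
Variables (gam : mi) (x' y' p q : O).
Hypothesis bezout : x' * p + y' * q = 1.
Let x := zpow F gam * x'.
Let y := zpow F gam * y'.

Definition mmul (N : set O) : set O := [set u | exists a b, [/\ N a, N b & u = x * a + y * b]].
(** For an R-module N this is z^gam (N : m), with the colon module taken in the total ring of
    fractions; the factor z^gam brings it into O. *)
Definition mcolon (N : set O) : set O := [set c | N (x' * c) /\ N (y' * c)].

Definition koszul1 (ab : O * O) : O := x * ab.1 + y * ab.2.
Lemma koszul1_is_linear : linear koszul1.
Proof.
move=> c u v; rewrite /koszul1 /= !mulrDr -!scaleOM addrACA -scalerDr; congr (_ + _).
Qed.
HB.instance Definition _ := GRing.isLinear.Build F (O * O)%type O _ koszul1 koszul1_is_linear.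

Definition koszul2 (c : O) : O * O := (y' * c, - (x' * c)).
Lemma koszul2_is_linear : linear koszul2.
Proof.
move=> c u v; rewrite -[RHS]/(c *: (y' * u) + y' * v, c *: - (x' * u) - x' * v).
by rewrite /koszul2 !mulrDr -!scaleOM scalerN opprD.
Qed.
HB.instance Definition _ := GRing.isLinear.Build F O (O * O)%type _ koszul2 koszul2_is_linear.

Lemma mmul_sub N : subspace N -> subspace (mmul N).
Proof.
move=> sN; have -> : mmul N = koszul1 @` [set ab | N ab.1 /\ N ab.2].
  apply/seteqP; split=> u; first by move=> [a [b [Na Nb ->]]]; exists (a, b).
  by move=> [[a b] [Na Nb] <-]; exists a, b.
apply: subspace_im; split; first by split; apply: subspace0.
  by move=> u v [? ?] [? ?]; split; apply: subspaceD.
by move=> c u [? ?]; split; apply: subspaceZ.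
Qed.

(** The Bezout relation says that x and y generate the O-ideal z^gam O. *)
Lemma mmul_zO N n : zO n `<=` N -> zO (fun i => (gam i + n i)%N) `<=` mmul N.
Proof.
move=> nN u hu.
have hu' : zO gam u by apply: zO_le hu => i; apply: leq_addr.
have zn : zO n (zdiv gam u) by move=> i j ji /=; apply: hu; rewrite addnC ltn_add2l.
exists (p * zdiv gam u), (q * zdiv gam u); split; try by apply: nN; apply: zO_mulr.
rewrite -{1}(zdivK hu') -[zdiv gam u in LHS]mul1r -bezout /x /y; ring.
Qed.

Lemma open_mmul N : open N -> open (mmul N).
Proof.
move=> [sN [n nN]]; split; first exact: mmul_sub.
by exists (fun i => (gam i + n i)%N); apply: mmul_zO.
Qed.

Lemma open_mcolon N : open N -> open (mcolon N).
Proof. by move=> oN; apply: openI; apply: open_preim. Qed.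

Lemma mmul_gam N : mmul N `<=` zO gam.
Proof.
by move=> _ [a [b [_ _ ->]]]; rewrite -!mulrA -mulrDr; apply: zO_zpow.
Qed.

(** The map (a, b) -> x a + y b of O^2 onto z^gam O sends N^2 onto m N, and its kernel is O,
    embedded by d -> (y' d, - x' d), because x' and y' generate the unit ideal.  The kernel
    meets N^2 in [mcolon N].  Comparing codimensions gives the formula. *)
Lemma koszul_cod N : open N ->
  (cod (mmul N) + cod (mcolon N) = cod N + cod N + wt gam)%N.
Proof.
move=> oN; have sN := open_sub oN; have oM := open_mmul oN; have oT := open_mcolon oN.
pose V : set (O * O) := [set ab | mmul N (koszul1 ab)].
pose W : set (O * O) := [set ab | N ab.1 /\ N ab.2].
pose B : set (O * O) := [set ab | N ab.2].
have sV : subspace V by apply: (subspace_preim koszul1); apply: open_sub.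
have sB : subspace B by apply: (subspace_preim (@snd O O) sN).
have sW : subspace W.
  split; first by split; apply: subspace0.
    by move=> u v [? ?] [? ?]; split; apply: subspaceD.
  by move=> c u [? ?]; split; apply: subspaceZ.
have hV : has_quot_dim setT V (cod (mmul N) - wt gam).
  rewrite -(cod_zO F gam).
  apply: (iffRL (@quot_dim_iso _ _ _ koszul1 _ _ (zO gam) _ _ (subspaceT _) _ _ _ _)).
  - exact: open_sub oM.
  - by move=> ab _; rewrite /= /koszul1 /x /y -!mulrA -mulrDr; apply: zO_zpow.
  - move=> u hu; exists (p * zdiv gam u, q * zdiv gam u) => //.
    have e : koszul1 (p * zdiv gam u, q * zdiv gam u) = u.
      rewrite -[RHS](zdivK hu) -[zdiv gam u in RHS]mul1r -bezout /koszul1 /x /y /=; ring.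
    rewrite -[X in _ - X]/(koszul1 _) e subrr; apply: subspace0; exact: open_sub.
  - by [].
  - by apply: quot_cod => //; [exact: zO_subspace|exact: mmul_gam].
have WV : W `<=` V by move=> [a b] [Na Nb]; exists a, b.
have hW : has_quot_dim V W (cod (mcolon N)).
  apply: (iffLR (@quot_dim_iso _ _ _ koszul2 _ _ _ _ _ (subspaceT _) sW _ _ _)) (open_quot oT).
  - move=> c _; rewrite /V /= /koszul1 /=.
    have -> : x * (y' * c) + y * - (x' * c) = 0 by rewrite /x /y; ring.
    by apply: subspace0; apply: open_sub.
  - move=> [a b] [a0 [b0 [Na0 Nb0]]]; rewrite /koszul1 /= => e.
    exists (q * (a - a0) - p * (b - b0)) => //.
    have e' : x' * (a - a0) + y' * (b - b0) = 0.
      apply: (@zpowI _ _ gam); rewrite mulr0 -(subrr (x * a + y * b)) {2}e /x /y; ring.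
    have ea : y' * (q * (a - a0) - p * (b - b0)) = a - a0.
      transitivity ((x' * p + y' * q) * (a - a0) - p * (x' * (a - a0) + y' * (b - b0))).
        by ring.
      by rewrite bezout e' mulr0 subr0 mul1r.
    have eb : - (x' * (q * (a - a0) - p * (b - b0))) = b - b0.
      transitivity ((x' * p + y' * q) * (b - b0) - q * (x' * (a - a0) + y' * (b - b0))).
        by ring.
      by rewrite bezout e' mulr0 subr0 mul1r.
    by rewrite /W /= /koszul2 ea eb /= !subKr.
  - move=> c _; rewrite /mcolon /W /=; split=> [[? ?]|[? h]]; split=> //.
      exact: subspaceN.
    by rewrite -[x' * c]opprK; apply: subspaceN.
(* O^2 / N^2 is filtered by O x N, with both factors isomorphic to O / N. *)
have hB : has_quot_dim setT B (cod N).
  apply: (iffRL (@quot_dim_iso _ _ _ snd _ _ setT _ _ (subspaceT _) sN _ _ _)) (open_quot oN) => //.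
  by move=> u _; exists (0, u) => //=; rewrite subrr; apply: subspace0.
have hBW : has_quot_dim B W (cod N).
  apply: (iffRL (@quot_dim_iso _ _ _ fst _ _ setT _ _ sB sN _ _ _)) (open_quot oN) => //.
  - move=> u _; exists (u, 0); first exact: subspace0.
    by rewrite /= subrr; apply: subspace0.
  - by move=> [a b] Nb /=; split=> [[]|].
have h1 := quot_dim_add sV sW WV (@subsetT _ _) hV hW.
have h2 := quot_dim_add sB sW (fun _ => @proj2 _ _) (@subsetT _ _) hB hBW.
have := quot_dim_uniq sW h1 h2.
have := cod_le oM (zO_subspace F gam) (@mmul_gam N); rewrite cod_zO.
by lia.
Qed.

End Koszul.

(** * Gorenstein duality for plane curve singularities *)

Notation addi n m := (fun i => (n i + m i)%N).

Section PlaneRing.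
Variables (F : fieldType) (k : nat).
Notation O := ('I_k -> fps F).
Notation mi := ('I_k -> nat).

(** The data extracted from a plane curve singularity R inside O: the generators
    x = z^gam x' and y = z^gam y' of the maximal ideal, written with the largest common
    power of z, Bezout coefficients p, q for x' and y', and the exponent c of the conductor. *)
Record plane_ring (R : set O) (gam : mi) (x' y' p q : O) (c : mi) : Prop := PlaneRing {
  pr_sub : subspace R;
  pr_1 : R 1;
  pr_mul : forall u v, R u -> R v -> R (u * v);
  pr_x : R (zpow F gam * x');
  pr_y : R (zpow F gam * y');
  pr_gam : forall i, (0 < gam i)%N;
  pr_bez : x' * p + y' * q = 1;
  pr_gen : forall r, R r -> exists a, mmul gam x' y' R (r - a *: (1 : O));
  pr_cond : forall u, (forall v, R (u * v)) <-> zO c u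
}.

Variables (R : set O) (gam : mi) (x' y' p q : O) (c : mi).
Hypothesis HR : plane_ring R gam x' y' p q c.
Variable i0 : 'I_k.
Let x := zpow F gam * x'.
Let y := zpow F gam * y'.
Let sR : subspace R := pr_sub HR.
Let bezout := pr_bez HR.
Notation mmul := (mmul gam x' y').
Notation mcolon := (mcolon x' y').

Definition submod (M : set O) : Prop :=
  subspace M /\ forall r u, R r -> M u -> M (r * u).

Lemma condR : zO c `<=` R.
Proof. by move=> u hu; rewrite -[u]mulr1; apply: (iffRL (pr_cond HR u)). Qed.

Lemma openR : open R.
Proof. by split=> //; exists c; apply: condR. Qed.

Lemma submodR : submod R.
Proof. by split=> // r u; apply: (pr_mul HR). Qed.

Lemma submod_zO n : submod (zO n).
Proof. by split; [exact: zO_subspace | move=> r u _; apply: zO_mulr]. Qed.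

Lemma submod_zshift n M : submod M -> submod (zshift n M).
Proof.
move=> [sM hM]; split; first exact: zshift_sub.
by move=> r _ Rr [u Mu ->]; exists (r * u); [apply: hM | ring].
Qed.

Lemma mmul_0 u i : mmul R u -> u i 0%N = 0.
Proof.
move=> [a [b [_ _ ->]]]; have := @zO_zpow F k gam (x' * a + y' * b) i 0%N (pr_gam HR i).
by rewrite mulrDr !mulrA.
Qed.

Lemma const_coef r : R r -> forall i j, r i 0%N = r j 0%N.
Proof.
move=> /(pr_gen HR)[a h] i j; have /= := mmul_0 i h; have /= := mmul_0 j h.
by move=> /eqP; rewrite subr_eq0 => /eqP -> /eqP; rewrite subr_eq0 => /eqP ->.
Qed.

Lemma mmul_iff r : R r -> mmul R r <-> r i0 0%N = 0.
Proof.
move=> Rr; split=> [/mmul_0 -> //|r0]; have [a h] := pr_gen HR Rr.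
have /= := mmul_0 i0 h; rewrite r0 mulr1 sub0r => /eqP; rewrite oppr_eq0 => /eqP a0.
by rewrite a0 scale0r subr0 in h.
Qed.

Lemma R_exp r d : R r -> R (r ^+ d).
Proof.
by move=> Rr; elim: d => [|d IH]; rewrite ?expr0 ?exprS; [exact: (pr_1 HR)|apply: (pr_mul HR)].
Qed.

(** The inverse is a geometric series.  Its tail lies in the conductor z^c O, which is
    contained in R, and the finitely many other terms are in R. *)
Lemma R_unit r : R r -> r i0 0%N != 0 -> exists2 r', R r' & r * r' = 1.
Proof.
move=> Rr r0; pose a := r i0 0%N; pose h : O := 1 - a^-1 *: r.
have h0 i : h i 0%N = 0.
  by rewrite /= (const_coef Rr i i0) mulVf // subrr.
have Rh : R h by apply: subspaceB => //; [exact: (pr_1 HR)|apply: subspaceZ].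
have [u hu] : exists u, (1 - h) * u = 1.
  by apply: O_unit => i; rewrite /= (const_coef Rr i i0) mulVf // subrr subr0 oner_neq0.
have Ru : R u.
  have e : u = \sum_(j < wt c) h ^+ j + h ^+ wt c * u.
    transitivity ((1 - h) * u * \sum_(j < wt c) h ^+ j + h ^+ wt c * u); last by rewrite hu mul1r.
    rewrite mulrAC -[1 - h]opprB mulNr -subrX1; ring.
  rewrite e; apply: subspaceD => //; first by apply: subspace_sum => // j _; apply: R_exp.
  apply: condR; rewrite mulrC; apply: zO_mulr; apply: zO_exp => // i.
  by rewrite /wt (bigD1 i) //= leq_addr.
exists (a^-1 *: u); first exact: subspaceZ.
by rewrite -scaleOM mulrC scaleOM mulrC -hu /h subKr.
Qed.

Lemma mmul_submod M : submod M -> submod (mmul M).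
Proof.
move=> [sM hM]; split; first exact: mmul_sub.
move=> r _ Rr [a [b [Ma Mb ->]]]; exists (r * a), (r * b).
split; [exact: hM|exact: hM|ring].
Qed.

Lemma mmul_le M : submod M -> mmul M `<=` M.
Proof.
move=> [sM hM] _ [a [b [Ma Mb ->]]]; apply: subspaceD => //; apply: hM => //.
  exact: (pr_x HR).
exact: (pr_y HR).
Qed.

(** The colon module (z^B R : L).  The shift by B keeps the duals of small lattices
    inside O; the dual M* = (R : M) is the case B = 0. *)
Definition dual (B : mi) (L : set O) : set O := [set u | forall v, L v -> zshift B R (u * v)].

Section DualB.
Variable B : mi.
Let N := zshift B R.
Let sN : subspace N. Proof. exact: zshift_sub. Qed.
Let oN : open N. Proof. by apply: open_zshift; exact: openR. Qed.
Let mN : submod N. Proof. by apply: submod_zshift; exact: submodR. Qed.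

Lemma dual_submod L : submod (dual B L).
Proof.
split; first split.
- by move=> v Lv; rewrite mul0r; apply: subspace0.
- by move=> u v hu hv w Lw; rewrite mulrDl; apply: subspaceD => //; [apply: hu|apply: hv].
- move=> a u hu w Lw; rewrite mulrC -scaleOM mulrC; apply: subspaceZ => //; exact: hu.
- by move=> r u Rr hu w Lw; rewrite -mulrA; apply: mN.2 => //; apply: hu.
Qed.

Lemma dual_anti L L' : L' `<=` L -> dual B L `<=` dual B L'.
Proof. by move=> LL u hu v /LL; apply: hu. Qed.

Lemma dual_zO n : (forall i, n i <= B i + c i)%N ->
  dual B (zO n) = zO (fun i => (B i + c i - n i)%N).
Proof.
move=> nB; apply/seteqP; split=> u.
- move=> hu; have h1 w : N (zpow F n * u * w).
    by rewrite mulrAC mulrC; apply: hu; apply: zO_zpow.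
  have zB : zO B (zpow F n * u).
    by have := h1 1; rewrite mulr1 => -[v _ ->]; apply: zO_zpow.
  have : zO c (zdiv B (zpow F n * u)).
    apply: (iffLR (pr_cond HR _)) => w; have [v Rv e] := h1 w.
    suff -> : zdiv B (zpow F n * u) * w = v by [].
    by apply: (@zpowI _ _ B); rewrite mulrA zdivK.
  move=> h i j ji; have := h i (j + n i - B i)%N.
  rewrite -[zdiv _ _ _ _]/((zpow F n * u) i (j + n i - B i + B i)%N) zpowE.
  case: (leqP (B i) (j + n i)) => [le|lt].
    rewrite subnK // (ltnNge _ (n i)) leq_addl /= addnK; apply.
    by lia.
  by move=> _; have := zB i (j + n i)%N lt; rewrite zpowE (ltnNge _ (n i)) leq_addl /= addnK.
- move=> hu v hv; have := zO_mul hu hv.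
  have e : (fun i => (B i + c i - n i + n i)%N) = addi B c by apply/funext => i; rewrite subnK.
  rewrite e => h; exists (zdiv B (u * v)); last first.
    by rewrite zdivK //; apply: zO_le h => i; apply: leq_addr.
  by apply: condR => i j ji /=; apply: h; rewrite addnC ltn_add2l.
Qed.

Lemma zO_dual L : zO (addi B c) `<=` dual B L.
Proof.
rewrite -[zO _](_ : dual B (zO (fun=> 0%N)) = _); first exact: dual_anti.
by rewrite dual_zO //; congr zO; apply/funext => i; rewrite subn0.
Qed.

Lemma open_dual L : open (dual B L).
Proof. by split; [case: (dual_submod L)|exists (addi B c); apply: zO_dual]. Qed.

(** z^B R is free of rank one and R = F + m R. *)
Lemma rank_shift : has_quot_dim N (mmul N) 1.
Proof.
exists (fun=> zpow F B); split.
- by move=> _; exists 1; [exact: (pr_1 HR)|rewrite mulr1].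
- move=> _ [r Rr ->]; have [a [u [v [Ru Rv e]]]] := pr_gen HR Rr.
  exists (fun=> a); rewrite big_ord1; exists (zpow F B * u), (zpow F B * v).
  split; [by exists u|by exists v|].
  rewrite -[X in _ - a *: X]mulr1 scaleOM -mulrBr e; ring.
- move=> a; rewrite big_ord1 => -[_ [_ [[u Ru ->] [v Rv ->] e]]] i; rewrite ord1.
  have e' : a ord0 *: (1 : O) = zpow F gam * x' * u + zpow F gam * y' * v.
    apply: (@zpowI _ _ B); rewrite -scaleOM mulr1 e; ring.
  have : mmul R (a ord0 *: (1 : O)) by rewrite e'; exists u, v.
  by move/(mmul_0 i0) => /=; rewrite mulr1.
Qed.

(** The Gorenstein property: as R has rank one, the Koszul complex shows that the socle
    (R : m) / R is a line.  It is stated for z^B R and multiplied by z^gam. *)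
Lemma mcolon_shift : has_quot_dim (mcolon N) (zshift gam N) 1.
Proof.
have sub : zshift gam N `<=` mcolon N.
  move=> _ [n Nn ->]; split; rewrite mulrA; apply: mN.2 => //; rewrite mulrC.
    exact: (pr_x HR).
  exact: (pr_y HR).
have oT := open_mcolon x' y' oN.
apply/(cod_quot _ (open_zshift gam oN) (open_sub oT) sub); rewrite cod_zshift //.
have := koszul_cod gam bezout oN.
have := iffLR (cod_quot 1 (open_mmul gam bezout oN) sN (mmul_le mN)) rank_shift.
lia.
Qed.

(** Multiplication by e embeds the quotient of the two duals into the socle of K / z^B R,
    which is a line; here K is the total ring of fractions of R. *)
Lemma dual_step L L' e : submod L' -> submod L -> L' `<=` L -> L e ->
  (forall u, L u -> exists a, L' (u - a *: e)) -> L' (x * e) -> L' (y * e) ->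
  (cod (dual B L) <= cod (dual B L') + 1)%N.
Proof.
move=> mL' mL LL Le span xe ye.
have oT := open_mcolon x' y' oN.
have [] := @quot_dim_preim _ _ _ (mulO (zpow F gam * e)) (dual B L') (dual B L)
  (mcolon N) (zshift gam N) 1 _ _ _ _ _ _ mcolon_shift.
- exact: (dual_submod L').1.
- exact: open_sub.
- exact: zshift_sub.
- move=> _ [n Nn ->]; split; rewrite mulrA; apply: mN.2 => //; rewrite mulrC.
    exact: (pr_x HR).
  exact: (pr_y HR).
- move=> u hu; split; rewrite /mulO.
    have -> : x' * (zpow F gam * e * u) = u * (x * e) by rewrite /x; ring.
    exact: hu.
  have -> : y' * (zpow F gam * e * u) = u * (y * e) by rewrite /y; ring.
  exact: hu.
- move=> u hu; rewrite -[X in _ <-> X]/(zshift gam N (zpow F gam * e * u)) -mulrA.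
  rewrite -[X in _ <-> X]/([set w | zshift gam N (zpow F gam * w)] (e * u)) zshift_preim.
  split=> [h|h v /[dup] Lv /span[a La]]; first by rewrite mulrC; apply: h.
  rewrite -[v](subrK (a *: e)) mulrDr; apply: subspaceD => //; first exact: hu.
  by rewrite -scaleOM mulrC; apply: subspaceZ.
move=> d d1 /(cod_quot _ (open_dual L) (dual_submod L').1 (dual_anti LL)) ->.
by rewrite leq_add2l.
Qed.

(** Used to move an element outside of an open module to one that x and y multiply
    into the module. *)
Lemma kill_power (z : O) L' u : (forall i, z i 0%N = 0) -> submod L' -> open L' -> ~ L' u ->
  exists d, ~ L' (z ^+ d * u) /\ L' (z ^+ d.+1 * u).
Proof.
move=> z0 mL' [_ [n nL]] nu.
have ex : exists d, `[< L' (z ^+ d * u) >].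
  exists (wt n); apply/asboolP; apply: nL; rewrite mulrC; apply: zO_mulr.
  by apply: zO_exp => // i; rewrite /wt (bigD1 i) //= leq_addr.
case: (ex_minnP ex) => -[|d] /asboolP hd dmin; first by rewrite expr0 mul1r in hd.
exists d; split=> // h; have := dmin d; rewrite ltnn => /(_ _)/negP; apply; last by [].
exact/asboolP.
Qed.

(** Refine L' <= L to a chain of submodules with one-dimensional steps: each step raises
    the codimension of the dual by at most one. *)
Lemma chain_dual L L' : submod L' -> submod L -> open L' -> L' `<=` L ->
  (cod (dual B L) + cod L <= cod L' + cod (dual B L'))%N.
Proof.
move=> + mL; move Ed: (cod L' - cod L)%N => d.
elim: d L' Ed => [|d IH] L' Ed mL' oL' LL.
  have le := cod_le oL' mL.1 LL.
  have e : cod L' = cod L by lia.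
  by rewrite (cod_eq oL' mL.1 LL e) addnC.
have [u [Lu nu]] : exists u, L u /\ ~ L' u.
  apply/not_existsP => h; have LL' : L `<=` L'.
    by move=> u Lu; apply: contrapT => nu; apply: (h u).
  have e : L' = L by apply/seteqP.
  by rewrite e subnn in Ed.
have x0 i : x i 0%N = 0 by apply: zO_zpow; apply: (pr_gam HR).
have y0 i : y i 0%N = 0 by apply: zO_zpow; apply: (pr_gam HR).
have [d1 [n1 l1]] := kill_power x0 mL' oL' nu.
have [d2 [n2 l2]] := kill_power y0 mL' oL' n1.
(* e lies outside of L', but x e and y e lie in L'. *)
pose e := y ^+ d2 * (x ^+ d1 * u).
have Ry d' : R (y ^+ d') by apply: R_exp; exact: (pr_y HR).
have Rx d' : R (x ^+ d') by apply: R_exp; exact: (pr_x HR).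
have xe : L' (x * e).
  have -> : x * e = y ^+ d2 * (x ^+ d1.+1 * u) by rewrite /e exprS; ring.
  by apply: mL'.2.
have ye : L' (y * e) by rewrite /e mulrA -exprS.
have Le : L e by apply: mL.2 => //; apply: mL.2.
pose L2 : set O := [set v | exists a, L' (v - a *: e)].
have L2E v a : L' v -> L2 (v + a *: e) by move=> h; exists a; rewrite addrK.
have sL2 : subspace L2.
  split; first by exists 0; rewrite scale0r subr0; exact: subspace0 mL'.1.
    move=> v w [a ha] [b hb]; exists (a + b).
    by rewrite scalerDl opprD addrACA; apply: subspaceD => //; case: mL'.
  move=> a v [b hb]; exists (a * b); rewrite -scalerA -scalerBr.
  by apply: subspaceZ => //; case: mL'.
have L'2 : L' `<=` L2 by move=> v Lv; rewrite -[v]addr0 -(scale0r e); apply: L2E.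
have mL2 : submod L2.
  split=> // r v Rr [a ha]; have [b [r1 [r2 [Rr1 Rr2 er]]]] := pr_gen HR Rr.
  exists (a * b).
  have -> : r * v - (a * b) *: e = r * (v - a *: e) + a *: (r1 * (x * e) + r2 * (y * e)).
    have -> : r1 * (x * e) + r2 * (y * e) = (r - b *: (1 : O)) * e by rewrite er /x /y; ring.
    rewrite mulrBl [(b *: (1 : O)) * e]mulrC -scaleOM mulr1 mulrBr -scaleOM scalerBr scalerA.
    ring.
  apply: subspaceD; [exact: mL'.1|exact: mL'.2|].
  by apply: subspaceZ; [exact: mL'.1|]; apply: subspaceD; [exact: mL'.1|apply: mL'.2|apply: mL'.2].
have L2L : L2 `<=` L.
  move=> v [a ha]; rewrite -[v](subrK (a *: e)); apply: (subspaceD mL.1); first exact: LL.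
  exact: subspaceZ mL.1 _ _ Le.
have c2 : cod L' = (cod L2 + 1)%N.
  apply/(cod_quot _ oL' sL2 L'2); exists (fun=> e); split.
  - by move=> _; rewrite -[e]add0r -[e]scale1r; apply: L2E; exact: subspace0 mL'.1.
  - by move=> v [a ha]; exists (fun=> a); rewrite big_ord1.
  - move=> a; rewrite big_ord1 => h i; rewrite ord1; apply: contrapT => /eqP an0.
    by apply: n2; rewrite -/e -[e]scale1r -(mulVf an0) -scalerA; apply: subspaceZ => //; case: mL'.
have o2 : open L2 by apply: open_le L'2.
have L2e : L2 e by rewrite -[e]add0r -[X in 0 + X]scale1r; apply: L2E; exact: subspace0 mL'.1.
have st := dual_step mL' mL2 L'2 L2e (fun v h => h) xe ye.
have lt := cod_le o2 mL.1 L2L.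
by have := IH L2 ltac:(lia) mL2 o2 L2L; lia.
Qed.

(** The chain inequality between z^(B+c) O and L, and between L and O.  The duals of the two
    extreme modules are known, and force both inequalities to be equalities. *)
Lemma cod_dual L : submod L -> zO (addi B c) `<=` L ->
  (cod L + cod (dual B L) = wt (addi B c))%N.
Proof.
move=> mL zL; have oL : open L by split; [case: mL|exists (addi B c)].
have mT : submod setT by split; first exact: subspaceT.
have d1 : dual B setT = zO (addi B c).
  have -> : [set: O] = zO (fun=> 0%N) by apply/seteqP; split.
  by rewrite dual_zO //; congr zO; apply/funext => i; rewrite subn0.
have d2 : dual B (zO (addi B c)) = setT.
  rewrite dual_zO //; apply/seteqP; split=> // u _ i j; by rewrite subnn.
have c0 : cod [set: O] = 0%N.
  by apply: codE (subspaceT _) _; apply/quot_dim0 => //; exact: subspaceT.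
have := chain_dual mL mT oL (@subsetT _ _).
have := chain_dual (submod_zO _) mL (open_zO _ _) zL.
by rewrite d1 d2 c0 cod_zO; lia.
Qed.

(** L is contained in its bidual and both have the same codimension. *)
Lemma dualK L : submod L -> zO (addi B c) `<=` L -> dual B (dual B L) = L.
Proof.
move=> mL zL; have oL : open L by split; [case: mL|exists (addi B c)].
have mD := dual_submod L.
apply/esym/cod_eq => //; first exact: (dual_submod _).1.
  by move=> u Lu v hv; rewrite mulrC; apply: hv.
have := cod_dual mL zL; have := cod_dual mD (@zO_dual L); lia.
Qed.
End DualB.

Definition dual0 : set O -> set O := dual (fun=> 0%N).

Lemma dual0E L u : dual0 L u <-> forall v, L v -> R (u * v).
Proof.
have zE w : zshift (fun=> 0%N) R w <-> R w.
  by split=> [[v Rv ->]|Rw]; [rewrite zpow0 mul1r | exists w; rewrite // zpow0 mul1r].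
by split=> h v /h /zE.
Qed.

Definition rk (M : set O) : nat := (cod (mmul M) - cod M)%N.

Lemma rk_quot M : submod M -> open M -> has_quot_dim M (mmul M) (rk M).
Proof.
by move=> mM oM; apply: quot_cod; [exact: (open_mmul gam bezout oM)|case: mM|exact: mmul_le].
Qed.

Lemma cod_dual0 L : submod L -> zO c `<=` L -> (cod L + cod (dual0 L) = wt c)%N.
Proof. by move=> mL zL; rewrite cod_dual. Qed.

Lemma dual0K L : submod L -> zO c `<=` L -> dual0 (dual0 L) = L.
Proof. by move=> mL zL; apply: dualK. Qed.

Lemma zO_dual0 L : zO c `<=` dual0 L.
Proof. exact: (@zO_dual (fun=> 0%N)). Qed.

Lemma dual0_zO n : (forall i, n i <= c i)%N -> dual0 (zO n) = zO (fun i => (c i - n i)%N).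
Proof. by move=> nc; rewrite /dual0 dual_zO. Qed.

Lemma dual0_sum A B : subspace A -> subspace B -> dual0 (sum_set A B) = dual0 A `&` dual0 B.
Proof.
move=> sA sB; apply/seteqP; split=> u.
  move=> hu; split; apply/dual0E => v hv; apply: (iffLR (dual0E _ _) hu).
    by exists v, 0; rewrite addr0; split=> //; apply: subspace0.
  by exists 0, v; rewrite add0r; split=> //; apply: subspace0.
move=> [/dual0E hA /dual0E hB]; apply/dual0E => _ [a [b [Aa Bb ->]]].
by rewrite mulrDr; apply: subspaceD => //; [apply: hA|apply: hB].
Qed.

Lemma dual0R : dual0 R = R.
Proof.
apply/seteqP; split=> u; first by move=> /dual0E/(_ 1 (pr_1 HR)); rewrite mulr1.
by move=> Ru; apply/dual0E => v; apply: (pr_mul HR).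
Qed.

(** R is its own dual. *)
Lemma cod_R : (cod R + cod R = wt c)%N.
Proof. by rewrite -(cod_dual0 submodR condR) dual0R. Qed.

(** u m M* is contained in z^gam R iff x' u and y' u lie in M** = M. *)
Lemma dual_mmul_dual0 M : submod M -> zO c `<=` M -> dual gam (mmul (dual0 M)) = mcolon M.
Proof.
move=> mM zM; have sD := (dual_submod (fun=> 0%N) M).1.
apply/seteqP; split=> u.
  move=> hu; rewrite -(dual0K mM zM); split; apply/dual0E => v hv.
    have [|r Rr e] := hu (x * v).
      by exists v, 0; rewrite mulr0 addr0; split=> //; exact: subspace0 sD.
    suff -> : x' * u * v = r by [].
    by apply: (@zpowI _ _ gam); rewrite -e /x; ring.
  have [|r Rr e] := hu (y * v).
    by exists 0, v; rewrite mulr0 add0r; split=> //; exact: subspace0 sD.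
  suff -> : y' * u * v = r by [].
  by apply: (@zpowI _ _ gam); rewrite -e /y; ring.
move=> [ux uy] _ [a [b [/dual0E Da /dual0E Db ->]]].
exists (a * (x' * u) + b * (y' * u)); last by ring.
by apply: subspaceD => //; [apply: Da|apply: Db].
Qed.

(** By the previous lemma, the codimensions of m M* and of [mcolon M] are complementary, and
    the Koszul formula computes the latter from m M. *)
Lemma rk_dual0 M : submod M -> zO c `<=` M -> rk (dual0 M) = rk M.
Proof.
move=> mM zM; have oM : open M by split; [case: mM|exists c].
have mD := dual_submod (fun=> 0%N) M.
have oD := open_dual (fun=> 0%N) M.
have zm : zO (addi gam c) `<=` mmul (dual0 M).
  by apply: (mmul_zO bezout); apply: zO_dual0.
have := cod_dual (mmul_submod mD) zm; rewrite dual_mmul_dual0 //.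
have := cod_dual0 mM zM; have := koszul_cod gam bezout oM.
have -> : wt (addi gam c) = (wt gam + wt c)%N by rewrite /wt big_split.
have := cod_le (open_mmul gam bezout oM) mM.1 (mmul_le mM).
have := cod_le (open_mmul gam bezout oD) mD.1 (mmul_le mD).
rewrite /rk -/(dual0 M); lia.
Qed.

End PlaneRing.

(** * Counting truncated power series *)

Section Truncation.
Variables (F : finFieldType) (k C : nat).
Notation O := ('I_k -> fps F).
Notation mi := ('I_k -> nat).
Hypothesis C0 : (0 < C)%N.

Notation Q := {ffun 'I_k * 'I_C -> F}.
Definition of_trunc (t : Q) : O :=
  fun i => Fps (fun j => oapp (fun j' : 'I_C => t (i, j')) 0 (insub j)).
Definition trunc (u : O) : Q := [ffun ij : 'I_k * 'I_C => u ij.1 (ij.2 : nat)].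

Lemma of_truncD s t : of_trunc (s + t) = of_trunc s + of_trunc t.
Proof.
apply: OP => i j /=; case: insubP => [j' _ _|_] /=; rewrite ?ffunE //.
by rewrite addr0.
Qed.

Lemma truncK u i (j : nat) : (j < C)%N -> of_trunc (trunc u) i j = u i j.
Proof. by move=> jC; rewrite /= insubT /= ffunE. Qed.

Lemma truncK_zO u : zO (fun=> C) (of_trunc (trunc u) - u).
Proof. by move=> i j jC; rewrite -[LHS]/(of_trunc (trunc u) i j - u i j) truncK // subrr. Qed.

Lemma truncK_mem (A : set O) u : subspace A -> zO (fun=> C) `<=` A ->
  A (of_trunc (trunc u)) <-> A u.
Proof.
move=> sA zA; have h := zA _ (truncK_zO u); split=> [hA|]; last exact: subspaceBr.
by apply: (subspaceBl sA h).
Qed.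

(** Elements of O modulo z^C O are represented by their truncations, so this is the order of
    A / z^C O when A contains z^C O. *)
Definition count_in (A : set O) : nat := #|[pred t : Q | `[< A (of_trunc t) >]]|.

(** Each truncation lies in exactly one coset of A, and the cosets all contain the same
    number of truncations. *)
Lemma count_in_cod (A : set O) : subspace A -> zO (fun=> C) `<=` A ->
  (count_in A * #|F| ^ cod A = #|Q|)%N.
Proof.
move=> sA zA; have oA : open A by split; last by exists (fun=> C).
have /has_quot_dimP[v [_ sp ind]] := open_quot oA.
have trans (e : 'rV_(cod A)) :
    (\sum_(t : Q) `[< A (of_trunc t - comb v e)%R >] = count_in A)%N.
  rewrite (reindex_inj (addIr (trunc (comb v e)))) /= /count_in -sum1_card [RHS]big_mkcond /=.
  apply: eq_bigr => t _; rewrite of_truncD -addrA.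
  have -> : `[< A (of_trunc t + (of_trunc (trunc (comb v e)) - comb v e)) >] =
      `[< A (of_trunc t) >].
    apply: asbool_equiv_eq; have h := zA _ (truncK_zO (comb v e)).
    split=> h'; last exact: subspaceD.
    by rewrite -[of_trunc t](addrK (of_trunc (trunc (comb v e)) - comb v e)); apply: subspaceB.
  by rewrite inE; case: asbool.
have -> : (#|F| ^ cod A = #|{: 'rV[F]_(cod A)}|)%N by rewrite card_mx mul1n.
rewrite mulnC -sum_nat_const (eq_bigr _ (fun e _ => esym (trans e))) exchange_big /=.
rewrite -sum1_card; apply: eq_bigr => t _.
have [e He] := sp (of_trunc t) I; rewrite (bigD1 e) //= asboolT // big1 // => e' ne.
rewrite asboolF // => He'; case/eqP: ne; apply/eqP; rewrite -subr_eq0; apply/eqP/ind.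
have -> : comb v (e' - e) = (of_trunc t - comb v e) - (of_trunc t - comb v e').
  by rewrite linearB /= opprB [RHS]addrC addrA subrK.
exact: subspaceB.
Qed.

Definition qn : rat := #|F|%:R.
Lemma qn_neq0 : qn != 0.
Proof. by rewrite /qn pnatr_eq0 -lt0n; apply/card_gt0P; exists 0. Qed.

Lemma count_inE (A : set O) : subspace A -> zO (fun=> C) `<=` A ->
  (count_in A)%:R = #|Q|%:R * qn ^- cod A.
Proof.
move=> sA zA; rewrite -(count_in_cod sA zA) natrM natrX -/qn mulfK //.
by rewrite expf_neq0 // qn_neq0.
Qed.

Definition unitQ (t : Q) : bool := [forall i, of_trunc t i 0%N != 0].
Definition count_unit (A : set O) : nat := #|[pred t : Q | unitQ t && `[< A (of_trunc t) >]]|.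

Definition ind (I : {set 'I_k}) : mi := fun i => i \in I.

Lemma wt_ind I : wt (ind I) = #|I|.
Proof. by rewrite /wt /ind -sum1_card [RHS]big_mkcond; apply: eq_bigr => i _; case: (i \in I). Qed.

(** Inclusion-exclusion over the set I of branches on which t is not a unit. *)
Lemma unitQ_incl_excl (t : Q) :
  (unitQ t)%:R = \sum_(I : {set 'I_k}) (-1) ^+ #|I| * `[< zO (ind I) (of_trunc t) >]%:R :> rat.
Proof.
transitivity (\prod_(i < k) (- (of_trunc t i 0%N == 0)%:R + 1) : rat).
  rewrite /unitQ; case: forallP => [h|/forallP/forallPn[i /negbNE/eqP ri]].
    by rewrite big1 // => i _; rewrite (negPf (h i)) oppr0 add0r.
  by apply/esym/eqP/prodf_eq0; exists i => //; rewrite ri eqxx addNr.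
rewrite bigA_distr; apply: eq_bigr => I _; rewrite -big_mkcond.
rewrite prodrN; congr (_ * _); case: asboolP => [h|h].
  by rewrite big1 // => i iI; rewrite h ?eqxx // /ind iI.
have [i iI ri] : exists2 i, i \in I & of_trunc t i 0%N != 0.
  apply/exists_inP; apply: contrapT => /negP; rewrite negb_exists_in => /forall_inP h'.
  apply: h => i j; rewrite /ind; case: (boolP (i \in I)) => // /h'.
  by rewrite negbK => /eqP h0; case: j.
by apply/eqP/prodf_eq0; exists i => //; rewrite (negPf ri).
Qed.

Lemma count_unitE (A : set O) : subspace A -> zO (fun=> C) `<=` A ->
  (count_unit A)%:R =
  #|Q|%:R * \sum_(I : {set 'I_k}) (-1) ^+ #|I| * qn ^- cod (A `&` zO (ind I)).
Proof.
move=> sA zA; rewrite /count_unit -sum1_card natr_sum [LHS]big_mkcond /=.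
transitivity (\sum_(t : Q) (unitQ t)%:R * `[< A (of_trunc t) >]%:R : rat).
  by apply: eq_bigr => t _; rewrite inE; do 2 case: (X in nat_of_bool X) => //=;
   rewrite ?mulr0 ?mul0r ?mulr1.
transitivity (\sum_(t : Q) \sum_(I : {set 'I_k})
    (-1) ^+ #|I| * `[< zO (ind I) (of_trunc t) >]%:R * `[< A (of_trunc t) >]%:R : rat).
  by apply: eq_bigr => t _; rewrite -mulr_suml -unitQ_incl_excl.
rewrite exchange_big mulr_sumr; apply: eq_bigr => I _; rewrite mulrCA -count_inE.
- rewrite /count_in -[X in _ = _ * X%:R]sum1_card natr_sum [X in _ * X]big_mkcond mulr_sumr.
  apply: eq_bigr => t _ /=.
  rewrite inE -mulrA; congr (_ * _); rewrite asbool_and andbC.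
  by case: `[< A _ >]; case: `[< zO _ _ >]; rewrite ?mulr0 ?mulr1.
- by apply: subspaceI => //; apply: zO_subspace.
- move=> u hu; split; first exact: zA.
  by apply: zO_le hu => i; rewrite /ind; case: (i \in I).
Qed.

End Truncation.

(** * Normalized lattices and the average over units *)

Section Lattices.
Variables (F : finFieldType) (k : nat).
Notation O := ('I_k -> fps F).
Notation mi := ('I_k -> nat).
Variables (R : set O) (gam : mi) (x' y' p q : O) (c : mi).
Hypothesis HR : plane_ring R gam x' y' p q c.
Variable i0 : 'I_k.
Notation submod := (submod R).
Notation mmul := (mmul gam x' y').
Notation dual0 := (dual0 R).
Notation rk := (rk gam x' y').

(** The R-modules M with O M = O. *)
Definition normalized : set (set O) :=
  [set M | submod M /\ forall i, exists2 u, M u & u i 0%N != 0].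

Lemma mono_mul (u : O) i j l : (mono F i 0 * u) j l = if j == i then u j l else 0.
Proof. by rewrite mono_mulE; case: eqP => // _; rewrite zpowE subn0. Qed.

(** On branch i, the conductor multiplied by an element of M that is a unit there is the
    conductor again. *)
Lemma normalized_zO M : normalized M -> zO c `<=` M.
Proof.
move=> [mM hM] w hw.
have -> : w = \sum_(i < k) mono F i 0 * w.
  apply/funext => j; rewrite (big_morph (fun f : O => f j) (id1 := 0) (op1 := +%R)) //.
  apply/fpsP => l; rewrite fps_sumE.
  rewrite (bigD1 j) //= -[X in X + _]/((mono F j 0 * w) j l) mono_mul eqxx.
  rewrite big1 ?addr0 // => i ij.
  by rewrite -[LHS]/((mono F i 0 * w) j l) mono_mul eq_sym (negPf ij).
apply: (subspace_sum mM.1) => i _; have [u Mu ui] := hM i.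
(* Completed by 1 on the other branches, u becomes invertible. *)
have [|g Hg] := @O_unit F k (fun j => if j == i then u i else 1).
  by move=> j /=; case: (j == i); [exact: ui | exact: oner_neq0].
have -> : mono F i 0 * w = (mono F i 0 * w * g) * u.
  apply/funext => j; rewrite -[RHS]/((mono F i 0 * w * g) j * u j).
  have h : j = i -> g j * u j = 1.
    move=> ->; have := congr1 (fun f : O => f i) Hg.
    by rewrite -[LHS]/((if i == i then u i else 1) * g i) eqxx mulrC.
  have [e|ne] := eqVneq j i.
    by rewrite -[(_ * _ * _) j]/((mono F i 0 * w) j * g j) -mulrA h // mulr1.
  have z : (mono F i 0 * w) j = 0 by apply/fpsP => l; rewrite mono_mul (negPf ne).
  by rewrite -[(_ * _ * _) j]/((mono F i 0 * w) j * g j) z !mul0r.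
apply: mM.2 => //; apply: (condR HR); rewrite mulrC; do 2 apply: zO_mulr.
exact: hw.
Qed.

Lemma normalized_open M : normalized M -> open M.
Proof. by move=> hM; split; [case: hM => -[]|exists c; apply: normalized_zO]. Qed.

(** Any level beyond all the conductor exponents works; it must be positive for units to
    be visible. *)
Definition clevel := (wt c).+1.

Lemma zO_clevel : (zO (fun=> clevel) : set O) `<=` zO c.
Proof. by apply: zO_le => i; rewrite /clevel /wt (bigD1 i) //= leqW // leq_addr. Qed.

(** A normalized lattice is determined by the truncations of its elements. *)
Lemma finite_normalized : finite_set normalized.
Proof.
pose f (M : set O) : {set {ffun 'I_k * 'I_clevel -> F}} := finset (fun t => `[< M (of_trunc t) >]).
pose g (T : {set {ffun 'I_k * 'I_clevel -> F}}) : set O := [set u | trunc clevel u \in T].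
apply: (@sub_finite_set _ _ (g @` setT)); last by apply: finite_image; exact: finite_finset.
move=> M hM; exists (f M) => //; apply/seteqP.
have E u : g (f M) u <-> M u.
  have := @truncK_mem F k clevel M u (open_sub (normalized_open hM))
    (subset_trans zO_clevel (normalized_zO hM)).
  by rewrite /g /f /= inE => <-; split=> [/asboolP|h] //; apply/asboolP.
by split=> u /E.
Qed.

(** Multiplication by the inverse of g when g is a unit; the preimage form avoids the
    inverse. *)
Definition act (g : O) (M : set O) : set O := [set v | M (g * v)].

Section Act.
Variables (g h : O).
Hypothesis gh : g * h = 1.

Lemma actK M : act h (act g M) = M.
Proof. by rewrite /act; apply/seteqP; split=> u /=; rewrite mulrA gh mul1r. Qed.

Lemma act_submod M : submod M -> submod (act g M).
Proof.
move=> [sM hM]; split; first exact: (subspace_preim (mulO g) sM).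
by move=> r u Rr Mu; rewrite /act /= mulrCA; apply: hM.
Qed.

Lemma act_normalized M : normalized M -> normalized (act g M).
Proof.
move=> [mM hM]; split; first exact: act_submod.
move=> i; have [u Mu ui] := hM i; exists (h * u).
  by rewrite /act /= mulrA gh mul1r.
by rewrite mulO_0 mulf_neq0 // (@O_unit_inv _ _ h g) // mulrC.
Qed.

Lemma cod_act M : open M -> cod (act g M) = cod M.
Proof.
move=> oM; have sM := open_sub oM; have oA := open_preim g oM.
apply: codE (open_sub oA) _.
apply: (iffRL (@quot_dim_iso _ _ _ (mulO g) _ _ setT _ _ (subspaceT _) sM _ _ _))
  (open_quot oM) => //.
by move=> u _; exists (h * u) => //; rewrite /= /mulO mulrA gh mul1r subrr; apply: subspace0.
Qed.

Lemma act_mmul M : mmul (act g M) = act g (mmul M).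
Proof.
apply/seteqP; split=> u.
  by move=> [a [b [Ma Mb ->]]]; exists (g * a), (g * b); split=> //; ring.
move=> [a [b [Ma Mb e]]]; exists (h * a), (h * b); rewrite /act /= !mulrA gh !mul1r; split=> //.
transitivity (g * h * u); first by rewrite gh mul1r.
rewrite mulrAC e; ring.
Qed.

Lemma rk_act M : open M -> rk (act g M) = rk M.
Proof.
move=> oM; rewrite /rk act_mmul !cod_act //.
exact: (open_mmul gam (pr_bez HR)).
Qed.

Lemma dual0_act M u : dual0 (act g M) u <-> dual0 M (u * h).
Proof.
split=> /dual0E H; apply/dual0E => v Mv.
  by rewrite -mulrA; apply: H; rewrite /act /= mulrA gh mul1r.
have -> : u * v = u * h * (g * v).
  by transitivity (g * h * (u * v)); [rewrite gh mul1r | ring].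
exact: H.
Qed.

End Act.

(** Multiplication by a unit u permutes the normalized lattices and turns the condition
    z^n in M* into z^n u in M*.  Sum over all truncated units. *)
Lemma average_units (E : comNzRingType) (f : set O -> E) (n : mi) :
  (forall g h M, g * h = 1 -> normalized M -> f (act g M) = f M) ->
  (\sum_(M \in normalized) f M * `[< dual0 M (zpow F n) >]%:R) *
     (count_unit clevel (setT : set O))%:R =
  \sum_(M \in normalized) f M * (count_unit clevel [set u | dual0 M (zpow F n * u)])%:R.
Proof.
move=> fact; have fin := finite_normalized.
have one (t : {ffun 'I_k * 'I_clevel -> F}) : unitQ t ->
    \sum_(M \in normalized) f M * `[< dual0 M (zpow F n) >]%:R =
    \sum_(M \in normalized) f M * `[< dual0 M (zpow F n * of_trunc t) >]%:R :> E.
  move=> /forallP /O_unit[g Hg]; have Hg' : g * of_trunc t = 1 by rewrite mulrC.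
  rewrite (reindex_fsbig (act g) normalized); last first.
    split; first by move=> M; apply: act_normalized Hg' _.
    - by move=> M M' _ _ /(congr1 (act (of_trunc t))); rewrite !actK.
    - by move=> M hM; exists (act (of_trunc t) M); [apply: act_normalized Hg _ _|rewrite actK].
  apply: eq_fsbigr => M; rewrite inE => hM; rewrite (fact _ (of_trunc t)) //; congr (_ * _%:R).
  by congr nat_of_bool; apply: asbool_equiv_eq; apply: dual0_act.
have cE (A : set O) : (count_unit clevel A)%:R =
    \sum_(t : {ffun 'I_k * 'I_clevel -> F} | unitQ t) `[< A (of_trunc t) >]%:R :> E.
  rewrite /count_unit -sum1_card natr_sum big_mkcond [RHS]big_mkcond.
  apply: eq_bigr => t _; rewrite inE.
  by case: (unitQ t) => //=; case: asbool.
rewrite cE mulr_sumr; under eq_bigr => t ut do rewrite asboolT // mulr1 (one t ut) fsbig_finite //.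
rewrite [RHS]fsbig_finite //= exchange_big /=; apply: eq_bigr => M _.
by rewrite cE mulr_sumr.
Qed.

Lemma count_unit_gt0 : (0 < count_unit clevel (setT : set O))%N.
Proof.
apply/card_gt0P; exists (trunc clevel 1); rewrite inE asboolT // andbT; apply/forallP => i.
by rewrite truncK //; exact: oner_neq0.
Qed.

Definition clip (n : mi) : mi := fun i => minn (n i) (c i).

(** Beyond the conductor exponent, multiplying by a higher power of z_i only changes an
    element of z^c O, which is contained in N. *)
Lemma mem_clip N n u : subspace N -> zO c `<=` N -> N (zpow F n * u) <-> N (zpow F (clip n) * u).
Proof.
move=> sN zN.
have h : N (zpow F n * u - zpow F (clip n) * u).
  apply: zN => i j ji; rewrite -[LHS]/((zpow F n * u) i j - (zpow F (clip n) * u) i j) !zpowE /clip.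
  case: (leqP (n i) (c i)) => nc; first by rewrite subrr.
  by rewrite ji (ltn_trans ji nc) subrr.
split=> h'; first exact: (subspaceBl sN h).
exact: (subspaceBr sN h).
Qed.

(** The codimension in O of the intersection of z^-n N with O. *)
Definition colon_cod (N : set O) (n : mi) : nat := cod [set u | N (zpow F n * u)].

Lemma colon_cod_clip N n : subspace N -> zO c `<=` N -> colon_cod N n = colon_cod N (clip n).
Proof.
move=> sN zN; congr cod; apply/seteqP; split=> u.
  exact: (iffLR (mem_clip n u sN zN)).
exact: (iffRL (mem_clip n u sN zN)).
Qed.

(** The dual of N + z^n O is the intersection of N* with z^(c-n) O; the modular law relates
    its codimension to that of the intersection of N with z^n O. *)
Lemma colon_cod_dual N n : submod N -> zO c `<=` N -> (forall i, n i <= c i)%N ->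
  (colon_cod N n + wt n = cod N + colon_cod (dual0 N) (fun i => c i - n i))%N.
Proof.
move=> mN zN nc; have oN : open N by split; [case: mN|exists c].
have oZ := open_zO F n; have sZ := open_sub oZ.
have mD := dual_submod HR (fun=> 0%N) N; have oD := open_dual HR (fun=> 0%N) N.
have h1 := cod_preim_zpow n oN.
have h2 := cod_preim_zpow (fun i => (c i - n i)%N) oD.
have h3 := cod_modular oN oZ.
have mS : submod (sum_set N (zO n)).
  split; first by apply: subspace_sumset => //; case: mN.
  move=> r _ Rr [a [b [Na Nb ->]]]; rewrite mulrDr; exists (r * a), (r * b); split=> //.
    exact: mN.2.
  exact: zO_mulr.
have zS : zO c `<=` sum_set N (zO n).
  move=> u hu; exists u, 0; rewrite addr0; split; [exact: zN| |by []].
  exact: subspace0 sZ.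
have h4 := cod_dual0 HR i0 mS zS.
rewrite (dual0_sum HR) ?(dual0_zO HR) // in h4; last by case: mN.
have h5 : (wt n + wt (fun i => c i - n i) = wt c)%N.
  by rewrite /wt -big_split; apply: eq_bigr => i _; rewrite /= subnKC.
rewrite cod_zO in h3.
rewrite /colon_cod; move: h1 h2 h3 h4 h5; rewrite /dual0.
lia.
Qed.

(** The Haar measure of the intersection of z^-n N with O, if O has measure one. *)
Definition vol (N : set O) (n : mi) : rat := qn F ^- colon_cod N n.

Lemma count_unit_vol N n : subspace N -> zO c `<=` N ->
  (count_unit clevel [set u | N (zpow F n * u)])%:R =
  #|{ffun 'I_k * 'I_clevel -> F}|%:R *
  \sum_(I : {set 'I_k}) (- (qn F)^-1) ^+ #|I| * vol N (clip (addi n (ind I))).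
Proof.
move=> sN zN; have oN : open N by split=> //; exists c.
have oA := open_preim (zpow F n) oN.
have zA : zO (fun=> clevel) `<=` [set u | N (zpow F n * u)].
  by move=> u /zO_clevel hu; apply: zN; apply: zO_mulr.
rewrite count_unitE //; last exact: open_sub.
congr (_ * _); apply: eq_bigr => I _; rewrite [in RHS]exprNn -[RHS]mulrA; congr (_ * _).
rewrite -cod_preim_zpow // wt_ind exprD invfM mulrC exprVn; congr (_ * _).
rewrite /vol -colon_cod_clip // /colon_cod; congr (_ ^- cod _).
by apply/seteqP; split=> u /=; rewrite zpowD mulrA.
Qed.

End Lattices.

(** * The polynomial identities behind the local factors *)

Section Theta.
Variables (E : comNzRingType).

(** The coefficients of the local polynomial in one branch with conductor exponent c;
    the parameter r stands for 1/q. *)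
Definition theta (r X : E) (c a : nat) : E :=
  if a == 0%N then (if c == 0%N then 1 - r else 1 - X)
  else X ^+ a.-1 * (X - r) * (if (a < c)%N then 1 - X else 1).

(** Congruence modulo m, used to compare truncated series in degrees below B. *)
Definition eqmod (m : E) (f g : E) : Prop := exists h, f = g + m * h.

Lemma eqmod_refl m f : eqmod m f f. Proof. by exists 0; rewrite mulr0 addr0. Qed.
Lemma eqmodD m f f' g g' : eqmod m f f' -> eqmod m g g' -> eqmod m (f + g) (f' + g').
Proof. by move=> [h ->] [h' ->]; exists (h + h'); ring. Qed.
Lemma eqmodM m f f' g g' : eqmod m f f' -> eqmod m g g' -> eqmod m (f * g) (f' * g').
Proof. by move=> [h ->] [h' ->]; exists (f' * h' + h * g' + m * h * h'); ring. Qed.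
Lemma eqmod_sum m I (s : seq I) (P : pred I) (f g : I -> E) :
  (forall i, P i -> eqmod m (f i) (g i)) ->
  eqmod m (\sum_(i <- s | P i) f i) (\sum_(i <- s | P i) g i).
Proof.
move=> h; apply: (big_ind2 (eqmod m)) => //; [exact: eqmod_refl | move=> *; exact: eqmodD].
Qed.
Lemma eqmod_prod m I (s : seq I) (P : pred I) (f g : I -> E) :
  (forall i, P i -> eqmod m (f i) (g i)) ->
  eqmod m (\prod_(i <- s | P i) f i) (\prod_(i <- s | P i) g i).
Proof.
move=> h; apply: (big_ind2 (eqmod m)) => //; [exact: eqmod_refl | move=> *; exact: eqmodM].
Qed.

Variables (r X : E).

Lemma sum_single B a : (a < B)%N ->
  \sum_(j < B | j == a :> nat) (1 - X) * X ^+ j = (1 - X) * X ^+ a.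
Proof. by move=> aB; rewrite (big_pred1 (Ordinal aB)). Qed.

Lemma sum_tail B a : (a <= B)%N ->
  \sum_(j < B | (a <= j)%N) (1 - X) * X ^+ j = X ^+ a - X ^+ B.
Proof.
move=> aB; rewrite -(big_mkord (fun j => a <= j)%N (fun j => (1 - X) * X ^+ j)).
rewrite (big_cat_nat (n := a)) //= big_nat_cond big1 ?add0r; last first.
  by move=> j /andP[/andP[_ ja] aj]; rewrite leqNgt ja in aj.
rewrite big_nat_cond (eq_bigl (fun j => (a <= j < B)%N && true)); last first.
  by move=> j; case: (a <= j)%N; rewrite ?andbT ?andbF.
rewrite -big_nat_cond -[RHS]opprB -telescope_sumr // -sumrN.
by apply: eq_bigr => j _; rewrite exprS; ring.
Qed.

(** In one branch the unit condition contributes r = 1/q times the volume one step further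
    (the summand j + 1), and the volumes are constant beyond c, where the powers of X add
    up to a geometric series. *)
Lemma theta_sum B c a : (c < B)%N -> (a <= c)%N ->
  eqmod (X ^+ B)
    (\sum_(j < B) ((if minn (j + 1) c == a then (1 - X) * X ^+ j * - r else 0) +
                   (if minn (j + 0) c == a then (1 - X) * X ^+ j else 0)))
    (theta r X c a).
Proof.
move=> cB ac; rewrite big_split /= -!big_mkcond /= -mulr_suml.
have h0 : eqmod (X ^+ B) (\sum_(j < B | minn (j + 0) c == a) (1 - X) * X ^+ j)
    (if (a < c)%N then (1 - X) * X ^+ a else X ^+ a).
  case: ltnP => [lt|le].
    rewrite (eq_bigl (fun j : 'I_B => j == a :> nat)); last by move=> j /=; lia.
    by rewrite sum_single ?(ltn_trans lt) //; exact: eqmod_refl.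
  rewrite (eq_bigl (fun j : 'I_B => a <= j)%N); last by move=> j /=; lia.
  by rewrite sum_tail; [exists (-1); ring | lia].
have h1 : eqmod (X ^+ B) (\sum_(j < B | minn (j + 1) c == a) (1 - X) * X ^+ j)
    (if a == 0%N then (if c == 0%N then 1 else 0)
     else if (a < c)%N then (1 - X) * X ^+ a.-1 else X ^+ a.-1).
  case: eqP => [a0|a0].
    case: eqP => [c0|c0].
      rewrite (eq_bigl (fun j : 'I_B => 0 <= j)%N); last by move=> j /=; lia.
      by rewrite sum_tail //; exists (-1); rewrite expr0; ring.
    rewrite big1; first exact: eqmod_refl.
    by move=> j; lia.
  case: ltnP => [lt|le].
    rewrite (eq_bigl (fun j : 'I_B => j == a.-1 :> nat)); last by move=> j /=; lia.
    by rewrite sum_single; [exact: eqmod_refl | lia].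
  rewrite (eq_bigl (fun j : 'I_B => a.-1 <= j)%N); last by move=> j /=; lia.
  by rewrite sum_tail; [exists (-1); ring | lia].
suff -> : theta r X c a = (if a == 0%N then (if c == 0%N then 1 else 0)
     else if (a < c)%N then (1 - X) * X ^+ a.-1 else X ^+ a.-1) * - r +
    (if (a < c)%N then (1 - X) * X ^+ a else X ^+ a).
  by apply: eqmodD => //; apply: eqmodM => //; exact: eqmod_refl.
rewrite /theta; case: a ac {h0 h1} => [|a] ac /=.
  by case: c ac {cB} => [|c] _ /=; rewrite expr0; ring.
by case: ltnP => _; rewrite exprS; ring.
Qed.

Section Multi.
Variables (k : nat) (c : 'I_k -> nat) (D : nat).
Hypothesis cD : forall i, (c i < D)%N.

Definition boxed (m : {ffun 'I_k -> 'I_D}) : bool := [forall i, (m i <= c i)%N].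

(** The numerator of the local zeta integral with volumes b. *)
Definition local_poly (b : ('I_k -> nat) -> E) : E :=
  \sum_(m | boxed m) b (fun i => m i) * \prod_i theta r X (c i) (m i).

Definition clipf (n : 'I_k -> nat) : {ffun 'I_k -> 'I_D} :=
  [ffun i => Ordinal (leq_ltn_trans (geq_minr (n i) (c i)) (cD i))].

(** Group the terms by the clipped exponent m, on which alone the volume depends.  The
    coefficient of b(m) is then a product over the branches of the sums in [theta_sum]. *)
Lemma box_sum (b : ('I_k -> nat) -> E) B : (forall i, (c i < B)%N) ->
  (forall n n', n =1 n' -> b n = b n') ->
  eqmod (X ^+ B)
   ((1 - X) ^+ k * \sum_(n : {ffun 'I_k -> 'I_B})
      (\sum_(I : {set 'I_k}) (- r) ^+ #|I| *
          b (fun i => minn (n i + (i \in I)) (c i)))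
        * X ^+ (\sum_i n i))
   (local_poly b).
Proof.
move=> cB bext.
(* The boolean tells whether i belongs to I.  The test singles out, one branch at a time,
   the terms whose clipped exponent is m. *)
pose phi i (m : {ffun 'I_k -> 'I_D}) (e : bool) (j : 'I_B) : E :=
  if minn (j + e) (c i) == m i :> nat then (1 - X) * X ^+ j * (if e then - r else 1) else 0.
have E1 (n : {ffun 'I_k -> 'I_B}) (I : {set 'I_k}) :
    (1 - X) ^+ k *
      ((- r) ^+ #|I| * b (fun i => minn (n i + (i \in I)) (c i)) * X ^+ (\sum_i n i)) =
    \sum_(m | boxed m) b (fun i => m i) *
      \prod_i (if i \in I then phi i m true (n i) else phi i m false (n i)).
  pose m0 := clipf (fun i => n i + (i \in I))%N.
  have bm0 : boxed m0 by apply/forallP => i; rewrite ffunE geq_minr.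
  rewrite (bigD1 m0) //= [X in _ = _ + X]big1 ?addr0.
    have -> : b (fun i => m0 i) = b (fun i => minn (n i + (i \in I)) (c i)).
      by apply: bext => i; rewrite ffunE.
    have -> : \prod_i (if i \in I then phi i m0 true (n i) else phi i m0 false (n i)) =
        \prod_i ((1 - X) * X ^+ n i * (if i \in I then - r else 1)).
      apply: eq_bigr => i _; rewrite /phi ffunE /=.
      by case: (i \in I); rewrite eqxx.
    rewrite !big_split /= -big_mkcond /= prodr_const prodr_const card_ord prodrXr.
    ring.
  move=> m /andP[bm ne]; have [i hi] : exists i, m i != m0 i.
    apply/existsP; apply: contraNT ne; rewrite negb_exists => /forallP h.
    by apply/eqP/ffunP => i; apply/eqP; have := h i; rewrite negbK.
  rewrite (bigD1 i) //= /phi; move: hi; rewrite ffunE -val_eqE /= eq_sym => /negPf.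
  by case: (i \in I) => /= ->; rewrite mul0r mulr0.
rewrite mulr_sumr; under eq_bigr => n _ do rewrite mulr_suml mulr_sumr
   (eq_bigr _ (fun I _ => E1 n I)) exchange_big /=.
rewrite exchange_big /=; apply: eqmod_sum => m bm.
under eq_bigr => n _ do rewrite -mulr_sumr -(bigA_distr _ _ (fun i => phi i m true (n i))) /=.
rewrite -mulr_sumr -(bigA_distr_bigA (fun i j => phi i m true j + phi i m false j)).
apply: eqmodM; first exact: eqmod_refl.
apply: eqmod_prod => i _; have /= := @theta_sum B (c i) (m i) (cB i) (forallP bm i).
suff -> : \sum_(j < B) (phi i m true j + phi i m false j) =
  \sum_(j < B) ((if minn (j + 1) (c i) == m i then (1 - X) * X ^+ j * - r else 0) +
                   (if minn (j + 0) (c i) == m i then (1 - X) * X ^+ j else 0)) by [].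
by apply: eq_bigr => j _; rewrite /phi /= mulr1.
Qed.

End Multi.
End Theta.

Section Reflection.
Variables (L : fieldType) (q T : L).
Hypotheses (q0 : q != 0) (T0 : T != 0).

(** The symmetry of the local factor under X -> 1/(qX). *)
Lemma theta_reflect c a : (a <= c)%N ->
  q ^+ a * theta q^-1 (q * T)^-1 c a * T ^+ c = theta q^-1 T c (c - a).
Proof.
move=> ac; rewrite /theta.
case: a ac => [|a] ac.
  rewrite subn0 ltnn expr0 mul1r /= mulr1; case: c {ac} => [|c] /=; first by rewrite expr0 mulr1.
  by rewrite exprS; field; rewrite q0 T0.
rewrite /=; move: (ac); rewrite leq_eqVlt => /orP[/eqP e|lt]; last first.
  rewrite lt subn_eq0 leqNgt lt /=.
  have -> : (c - a.+1 < c)%N by lia.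
  have -> : c = ((c - a.+1).-1 + a.+2)%N by lia.
  have -> : ((c - a.+1).-1 + a.+2 - a.+1).-1 = (c - a.+1).-1 by lia.
  move: (c - a.+1).-1 => d; rewrite exprD !exprS exprVn exprMn.
  by field; rewrite ?expf_neq0 // q0 T0.
rewrite -e ltnn subnn /= mulr1 !exprS exprVn exprMn.
by field; rewrite ?expf_neq0 // q0 T0.
Qed.

Variables (k : nat) (c : 'I_k -> nat) (D : nat).
Hypothesis cD : forall i, (c i < D)%N.

Definition flip (m : {ffun 'I_k -> 'I_D}) : {ffun 'I_k -> 'I_D} :=
  [ffun i => Ordinal (leq_ltn_trans (leq_subr (m i) (c i)) (cD i))].

Lemma local_poly_reflect (b b' : ('I_k -> nat) -> L) (e : L) :
  (forall n n', n =1 n' -> b' n = b' n') ->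
  (forall n, (forall i, n i <= c i)%N ->
     b n = q ^+ (\sum_i n i) * e * b' (fun i => (c i - n i)%N)) ->
  local_poly q^-1 (q * T)^-1 c D b * T ^+ (\sum_i c i) = e * local_poly q^-1 T c D b'.
Proof.
move=> bext hb; rewrite /local_poly mulr_suml mulr_sumr.
rewrite [RHS](reindex_onto flip flip) /=; last first.
  by move=> m /forallP bm; apply/ffunP => i; apply/val_inj; rewrite !ffunE /= subKn.
have eb m : boxed c (flip m) && (flip (flip m) == m) = boxed c m.
  apply/andP/idP => [[_ /eqP <-]|/forallP bm].
    by apply/forallP => i; rewrite ffunE leq_subr.
  split; first by apply/forallP => i; rewrite ffunE leq_subr.
  by apply/eqP/ffunP => i; apply/val_inj; rewrite !ffunE /= subKn.
rewrite (eq_bigl _ _ eb); apply: eq_bigr => m /forallP bm.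
rewrite hb // (bext _ (fun i => flip m i)); last by move=> i; rewrite ffunE.
have -> : \prod_i theta q^-1 T (c i) (flip m i) =
   q ^+ (\sum_i m i) * (\prod_i theta q^-1 (q * T)^-1 (c i) (m i)) * T ^+ (\sum_i c i).
  rewrite -!prodrXr -!big_split; apply: eq_bigr => i _ /=.
  by rewrite ffunE /= theta_reflect.
ring.
Qed.

End Reflection.

(** * Ideals as shifts of normalized lattices *)

Section Ideals.
Variables (F : finFieldType) (k : nat).
Notation O := ('I_k -> fps F).
Notation mi := ('I_k -> nat).
Variables (R : set O) (gam : mi) (x' y' p q : O) (c : mi).
Hypothesis HR : plane_ring R gam x' y' p q c.
Variable i0 : 'I_k.
Notation submod := (submod R).
Notation mmul := (mmul gam x' y').
Notation dual0 := (dual0 R).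
Notation rk := (rk gam x' y').
Notation normalized := (normalized R).
Notation clevel := (clevel c).

Definition ideals (e : nat) : set (set O) :=
  [set J | [/\ submod J, J `<=` R, open J & cod J = e]].

Lemma mmul_zshift n M : mmul (zshift n M) = zshift n (mmul M).
Proof.
apply/seteqP; split=> u.
  move=> [_ [_ [[a Ma ->] [b Mb ->] ->]]].
  by exists (zpow F gam * x' * a + zpow F gam * y' * b); [exists a, b | ring].
move=> [_ [a [b [Ma Mb ->]]] ->].
by exists (zpow F n * a), (zpow F n * b); split; [exists a|exists b|ring].
Qed.

Lemma rk_zshift n M : open M -> rk (zshift n M) = rk M.
Proof.
move=> oM; have oM' := open_mmul gam (pr_bez HR) oM.
by rewrite /rk mmul_zshift !cod_zshift // subnDr.
Qed.

(** n collects the minimal valuations of the elements of J on the branches. *)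
Lemma normalized_exists J : submod J -> open J ->
  exists n M, normalized M /\ J = zshift n M.
Proof.
move=> mJ oJ; have [N hN] := oJ.2.
have /choice[n Hn] : forall i, exists d, (exists2 u, J u & u i d != 0) /\
    forall j u, (j < d)%N -> J u -> u i j = 0.
  move=> i; have ex : exists d, `[< exists2 u, J u & u i d != 0 >].
    exists (N i); apply/asboolP; exists (zpow F N); last by rewrite /= eqxx oner_neq0.
    by apply: hN; rewrite -[zpow F N]mulr1; apply: zO_zpow.
  case: (ex_minnP ex) => d /asboolP hd dmin; exists d; split=> // j u jd Ju.
  apply/eqP; apply: contraLR jd => uj; rewrite -leqNgt; apply: dmin.
  by apply/asboolP; exists u.
have Jn : J `<=` zO n by move=> u Ju i j ji; apply: (Hn i).2 Ju.
exists n, [set v | J (zpow F n * v)]; split; last first.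
  apply/seteqP; split=> u; last by move=> [v Jv ->].
  by move=> Ju; exists (zdiv n u); rewrite /= zdivK //; apply: Jn.
split.
  split; first exact: (subspace_preim (mulO (zpow F n)) mJ.1).
  by move=> r u Rr Ju; rewrite /= mulrCA; apply: mJ.2.
move=> i; have [[u Ju ui] _] := Hn i; exists (zdiv n u); last exact: ui.
by rewrite /= zdivK //; apply: Jn.
Qed.

Lemma zshift_le n n' M M' : normalized M -> normalized M' -> zshift n M `<=` zshift n' M' ->
  forall i, (n' i <= n i)%N.
Proof.
move=> [_ hM] _ sub i; have [u Mu ui] := hM i.
have [|v _ e] := sub (zpow F n * u); first by exists u.
rewrite leqNgt; apply/negP => lt; case/eqP: ui.
have := zpowE n u i (n i); rewrite ltnn subnn => <-.
by rewrite e zpowE lt.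
Qed.

Lemma zshift_inj n n' M M' : normalized M -> normalized M' -> zshift n M = zshift n' M' ->
  n = n' /\ M = M'.
Proof.
move=> hM hM' e.
have en : n = n'.
  apply/funext => i; apply/eqP; rewrite eqn_leq (zshift_le hM' hM) ?(zshift_le hM hM') //.
    by rewrite e.
  by rewrite e.
by split=> //; rewrite -(zshift_preim n M) e -en zshift_preim.
Qed.

Lemma zshift_R n M : zshift n M `<=` R <-> dual0 M (zpow F n).
Proof.
split=> [sub|/dual0E h _ [v Mv ->]]; last exact: h.
by apply/dual0E => v Mv; apply: sub; exists v.
Qed.

Lemma wt_ge n i : (n i <= wt (n : mi))%N.
Proof. by rewrite /wt (bigD1 i) //= leq_addr. Qed.

(** The pairs (M, n) with z^n in M* parametrize the ideals z^n M.  Exponents at least B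
    contribute to higher codimensions only. *)
Lemma sum_ideals (E : comNzRingType) (f : nat -> E) (e B : nat) : (e < B)%N ->
  \sum_(J \in ideals e) f (rk J) =
  \sum_(n : {ffun 'I_k -> 'I_B})
     \sum_(M \in normalized) (f (rk M) * (cod M + wt (fun i => n i) == e)%N%:R)
            * `[< dual0 M (zpow F (fun i => n i)) >]%:R.
Proof.
move=> eB; pose I := {ffun 'I_k -> 'I_B}; pose nat_of (n : I) : mi := fun i => n i.
pose P (z : I * set O) :=
  (cod z.2 + wt (nat_of z.1) == e)%N && `[< dual0 z.2 (zpow F (nat_of z.1)) >].
pose D : set (I * set O) := (setT `*` normalized) `&` [set z | P z].
rewrite (reindex_fsbig (fun z : I * set O => zshift (nat_of z.1) z.2) D); last first.
  split.
  - move=> [n M] [[_ hM] /andP[/eqP h /asboolP d]]; have oM := normalized_open HR hM.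
    split; [by apply: submod_zshift; case: hM|exact/zshift_R|exact: open_zshift|].
    by rewrite cod_zshift.
  - move=> [n M] [n' M']; rewrite !inE => -[[_ hM] _] [[_ hM'] _] /= /(zshift_inj hM hM')[en /= ->].
    congr (_, _); apply/ffunP => i; apply/val_inj.
    exact: (congr1 (fun g : mi => g i) en).
  - move=> J [mJ JR oJ cJ]; have [n [M [hM eJ]]] := normalized_exists mJ oJ.
    have oM := normalized_open HR hM.
    have cM : (cod M + wt n = e)%N by rewrite -cod_zshift // -eJ.
    have nB i : (n i < B)%N.
      by apply: leq_ltn_trans eB; rewrite -cM; apply: leq_trans (wt_ge n i) (leq_addl _ _).
    have en : nat_of [ffun i => Ordinal (nB i)] = n by apply/funext => i; rewrite /nat_of ffunE.
    exists ([ffun i => Ordinal (nB i)], M); last by rewrite [_.1]/= en eJ.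
    split; first by split.
    suff: (cod M + wt (nat_of [ffun i => Ordinal (nB i)]) == e)%N &&
        `[< dual0 M (zpow F (nat_of [ffun i => Ordinal (nB i)])) >] by [].
    by rewrite en cM eqxx /=; apply/asboolP/zshift_R; rewrite -eJ.
rewrite fsbig_mkcondr.
transitivity (\sum_(n \in [set: I]) \sum_(M \in normalized)
   (f (rk M) * (cod M + wt (nat_of n) == e)%N%:R) * `[< dual0 M (zpow F (nat_of n)) >]%:R).
  rewrite (pair_fsbig _ _ (@finite_finset _ _) (finite_normalized HR)).
  apply: eq_fsbigr => -[n M]; rewrite inE => -[_ hM] /=.
  rewrite rk_zshift; last exact: (normalized_open HR hM).
  have -> : ((n, M) \in [set z | P z]) = P (n, M) by apply/idP/idP; rewrite inE.
  by rewrite /P /=; case: eqP => _; case: asbool; rewrite ?mulr1 ?mulr0 ?mul0r.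
rewrite (fsbigE (index_enum I)) //; first by apply: eq_bigl => n; rewrite in_setT.
  exact: index_enum_uniq.
by move=> n _; rewrite mem_index_enum.
Qed.

Lemma sum_ideals_units (E : comNzRingType) (f : nat -> E) (e B : nat) : (e < B)%N ->
  (\sum_(J \in ideals e) f (rk J)) * (count_unit clevel (setT : set O))%:R =
  \sum_(M \in normalized) \sum_(n : {ffun 'I_k -> 'I_B})
     (f (rk M) * (cod M + wt (fun i => n i) == e)%N%:R)
            * (count_unit clevel [set u | dual0 M (zpow F (fun i => n i) * u)])%:R.
Proof.
move=> eB; have fin := finite_normalized HR.
rewrite (sum_ideals f eB) mulr_suml.
under eq_bigr => n _.
  rewrite (average_units HR
    (f := fun M => f (rk M) * (cod M + wt (fun i => n i) == e)%N%:R)); last first.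
    move=> g h M gh hM; have oM := normalized_open HR hM.
    by rewrite (rk_act HR gh oM) (cod_act gh oM).
  rewrite fsbig_finite //; over.
by rewrite exchange_big [RHS]fsbig_finite.
Qed.

End Ideals.

(** * The L-polynomial *)

Lemma coef_eqmod (E : comNzRingType) (B j : nat) (f g : {poly E}) :
  eqmod ('X ^+ B) f g -> (j < B)%N -> f`_j = g`_j.
Proof. by move=> [h ->] jB; rewrite coefD coefXnM jB addr0. Qed.

Section LFunction.
Variables (F : finFieldType) (k : nat).
Notation O := ('I_k -> fps F).
Notation mi := ('I_k -> nat).
Variables (R : set O) (gam : mi) (x' y' p q : O) (c : mi).
Hypothesis HR : plane_ring R gam x' y' p q c.
Variable i0 : 'I_k.
Variable f : nat -> {poly rat}.
Notation submod := (submod R).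
Notation mmul := (mmul gam x' y').
Notation dual0 := (dual0 R).
Notation rk := (rk gam x' y').
Notation normalized := (normalized R).
Notation clevel := (clevel c).
Notation E := {poly rat}.
Notation ideals := (ideals R).

Lemma c_lt_clevel i : (c i < clevel)%N. Proof. by rewrite ltnS; apply: wt_ge. Qed.

Definition count_at (N : set O) (n : mi) : nat := count_unit clevel [set u | N (zpow F n * u)].
Definition num_units : nat := count_unit clevel (setT : set O).
Definition num_trunc : nat := #|{ffun 'I_k * 'I_clevel -> F}|.

Lemma num_trunc_gt0 : (0 < num_trunc)%N.
Proof. by apply/card_gt0P; exists [ffun=> 0]. Qed.

(** The local zeta series of N, truncated at exponents below B. *)
Definition series (N : set O) (B : nat) : {poly E} :=
  \sum_(n : {ffun 'I_k -> 'I_B}) (count_at N (fun i => n i))%:R * 'X ^+ (wt (fun i => n i)).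

Definition lpoly (N : set O) : {poly E} :=
  local_poly ((qn F)^-1)%:P%:P 'X c clevel (fun n => (vol N n)%:P%:P).

(** This determines [lpoly N] from the counts for N, without reference to the box 0 <= n <= c. *)
Lemma series_lpoly N B : subspace N -> zO c `<=` N -> (forall i, c i < B)%N ->
  eqmod ('X ^+ B) ((1 - 'X) ^+ k * series N B) (num_trunc%:R * lpoly N).
Proof.
move=> sN zN cB.
have [|h] := @box_sum {poly E} ((qn F)^-1)%:P%:P 'X k c clevel c_lt_clevel
  (fun n => (vol N n)%:P%:P) B cB.
  by move=> n n' /funext ->.
move=> e; exists (num_trunc%:R * h); rewrite mulrCA -mulrDr -e [RHS]mulrCA.
congr (_ * _); rewrite mulr_sumr.
apply: eq_bigr => n _; rewrite mulrA; congr (_ * _).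
have cE : (count_at N (fun i => n i))%:R = ((count_at N (fun i => n i))%:R : rat)%:P%:P :> {poly E}.
  by rewrite !rmorph_nat.
rewrite cE (count_unit_vol _ sN zN) !rmorphM /= !rmorph_nat; congr (_ * _).
rewrite !rmorph_sum; apply: eq_bigr => I _; rewrite /= !rmorphM /= !rmorphXn /= !rmorphN /=.
by [].
Qed.

(** For a unit u, z^n u lies in z^l M only if l <= n, since M is contained in O. *)
Lemma count_at_zshift l M n :
  count_at (zshift l M) n =
  if [forall i, (l i <= n i)%N] then count_at M (fun i => n i - l i)%N else 0%N.
Proof.
case: forallP => [ln|nln].
  apply: eq_card => t; rewrite !inE; congr (_ && _); apply: asbool_equiv_eq => /=.
  have en : zpow F n = zpow F l * zpow F (fun i => n i - l i)%N.
    by rewrite -zpowD; congr zpow; apply/funext => i; rewrite subnKC.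
  rewrite en -mulrA -[zshift l M _]/([set v | zshift l M (zpow F l * v)]
    (zpow F (fun i => n i - l i)%N * of_trunc t)).
  by rewrite zshift_preim.
apply: eq_card0 => t; rewrite !inE; apply/negP => /andP[/forallP ut /asboolP [v _ e]].
apply: nln => i; rewrite leqNgt; apply/negP => lt; have /eqP[] := ut i.
rewrite -[LHS]/(of_trunc t i 0%N); have := zpowE n (of_trunc t) i (n i).
by rewrite e zpowE lt ltnn subnn.
Qed.

Lemma coef_series N B e : (series N B)`_e =
  \sum_(n : {ffun 'I_k -> 'I_B} | wt (fun i => n i) == e) (count_at N (fun i => n i))%:R.
Proof.
rewrite /series coef_sum [RHS]big_mkcond; apply: eq_bigr => n _.
rewrite -[X in X * _](rmorph_nat polyC) coefCM coefXn eq_sym.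
by case: eqP; rewrite ?mulr1 ?mulr0.
Qed.

Lemma series_zshift l M B e : (e < B)%N ->
  (series (zshift l M) B)`_e = ('X ^+ wt l * series M B)`_e.
Proof.
case: B => // B eB; rewrite coefXnM !coef_series.
under eq_bigr => n _ do rewrite count_at_zshift.
rewrite (bigID (fun n : {ffun 'I_k -> 'I_B.+1} => [forall i, (l i <= n i)%N])) /=.
rewrite [X in _ + X]big1 ?addr0; last first.
  by move=> n /andP[_ /negPf->].
case: ltnP => [lt|le].
  rewrite big1 // => n /andP[/eqP w /forallP ln].
  by move: lt; rewrite -w ltnNge /wt leq_sum.
(* Reindex by the translation by l; in degree e < B no exponent reaches the bound B. *)
pose h (m : {ffun 'I_k -> 'I_B.+1}) : {ffun 'I_k -> 'I_B.+1} := [ffun i => inord (m i + l i)].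
pose h' (m : {ffun 'I_k -> 'I_B.+1}) : {ffun 'I_k -> 'I_B.+1} := [ffun i => inord (m i - l i)].
rewrite (reindex_onto h h') /=; last first.
  move=> n /andP[/eqP w /forallP ln]; apply/ffunP => i; apply/val_inj.
  rewrite !ffunE /= (@inordK B (n i - l i)); last first.
    by apply: leq_ltn_trans (leq_subr _ _) (ltn_ord _).
  by rewrite subnK ?ln // inordK // ltn_ord.
have hE (m : {ffun 'I_k -> 'I_B.+1}) : (wt (fun i => m i) = e - wt l)%N ->
    forall i, h m i = (m i + l i)%N :> nat.
  move=> w i; rewrite ffunE inordK //.
  have := wt_ge (fun i => m i) i; have := wt_ge l i; move: eB le w; rewrite !ltnS; lia.
have h'E (n : {ffun 'I_k -> 'I_B.+1}) i : h' n i = (n i - l i)%N :> nat.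
  by rewrite [h' n i]ffunE inordK //; apply: leq_ltn_trans (leq_subr _ _) (ltn_ord _).
apply: eq_big => m; last first.
  move=> /andP[/andP[/eqP w /forallP ln] /eqP hm]; rewrite (introT forallP ln).
  by congr ((count_at M _)%:R); apply/funext => i; rewrite -[in RHS]hm h'E.
have w2 (m' : mi) : (wt (fun i => m' i + l i) = wt m' + wt l)%N by rewrite /wt big_split.
apply/idP/idP.
  move=> /andP[/andP[/eqP w /forallP ln] /eqP hm].
  have mE i : (h m i = m i + l i :> nat)%N.
    by rewrite -[in RHS]hm h'E subnK.
  have fE : (fun i => h m i : nat) = (fun i => m i + l i)%N by apply/funext.
  by rewrite -w fE w2 addnK.
move=> /eqP w; have mE := hE m w.
have fE : (fun i => h m i : nat) = (fun i => m i + l i)%N by apply/funext.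
rewrite fE w2 w subnK // eqxx /=; apply/andP; split.
  by apply/forallP => i; rewrite mE leq_addl.
apply/eqP/ffunP => i; apply/val_inj; rewrite ffunE /= mE addnK inordK //.
Qed.

Lemma natp_neq0 (n : nat) : (0 < n)%N -> n%:R != 0 :> {poly E}.
Proof.
by move=> n0; rewrite -(rmorph_nat polyC) -(rmorph_nat polyC) !polyC_eq0 pnatr_eq0 -lt0n.
Qed.

(** The zeta series of z^l M is t^|l| times that of M; both sides agree modulo every power
    of the variable. *)
Lemma lpoly_zshift l M : subspace M -> zO c `<=` M -> zO c `<=` zshift l M ->
  lpoly (zshift l M) = 'X ^+ wt l * lpoly M.
Proof.
move=> sM zM zlM; apply: (mulfI (natp_neq0 num_trunc_gt0)); apply/polyP => e.
have cB i : (c i < (e + wt c).+1)%N by rewrite ltnS (leq_trans (wt_ge c i)) ?leq_addl.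
have eB : (e < (e + wt c).+1)%N by rewrite ltnS leq_addr.
rewrite -(coef_eqmod (series_lpoly (zshift_sub _ sM) zlM cB) eB).
rewrite mulrCA.
have h2 := eqmodM (eqmod_refl ('X ^+ (e + wt c).+1) ('X ^+ wt l)) (series_lpoly sM zM cB).
rewrite -(coef_eqmod h2 eB) mulrCA !coefM; apply: eq_bigr => j _; congr (_ * _).
by apply: series_zshift; apply: leq_ltn_trans (leq_subr _ _) eB.
Qed.

(** The L-polynomial up to the factor t^delta and the proportion of units in O. *)
Definition Gpoly : {poly E} :=
  \sum_(M \in normalized) (f (rk M))%:P * 'X ^+ cod M * lpoly (dual0 M).

(** Ideals are counted by their codimension in O, that is, delta more than their degree. *)
Definition ideal_series : fps E := Fps (fun e => \sum_(J \in ideals e) f (rk J)).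

Lemma fps_of_polyM (P1 P2 : {poly E}) : fps_of_poly (P1 * P2) = fps_of_poly P1 * fps_of_poly P2.
Proof. by apply/fpsP => n; rewrite /= coefM. Qed.

Lemma fps_of_poly1X : fps_of_poly ((1 - 'X) ^+ k : {poly E}) = (1 - fps_X) ^+ k.
Proof.
elim: (k) => [|n IH].
  by rewrite !expr0; apply/fpsP => -[|n] /=; rewrite coef1.
rewrite !exprS fps_of_polyM IH; congr (_ * _); apply/fpsP => -[|[|j]];
  by rewrite /= coefB coef1 coefX.
Qed.

(** Compare coefficients below a degree B beyond both j and c. *)
Lemma series_Gpoly j :
  num_units%:R * ((1 - fps_X) ^+ k * ideal_series) j = num_trunc%:R * Gpoly`_j.
Proof.
pose B := (j + wt c).+1.
have cB i : (c i < B)%N by rewrite ltnS (leq_trans (wt_ge c i)) ?leq_addl.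
have jB : (j < B)%N by rewrite ltnS leq_addr.
have fin := finite_normalized HR.
pose S : {poly E} := \sum_(M \in normalized) (f (rk M))%:P * 'X ^+ cod M * series (dual0 M) B.
have hS e : (e < B)%N -> S`_e = num_units%:R * ideal_series e.
  move=> eB; rewrite mulrC (sum_ideals_units HR f eB) /S !fsbig_finite // coef_sum.
  apply: eq_bigr => M _; rewrite -mulrA coefCM coefXnM coef_series.
  case: ltnP => [lt|le].
    rewrite mulr0 big1 // => n _; rewrite (_ : (_ == e) = false) ?mulr0 ?mul0r //.
    by apply/eqP => h; move: lt; rewrite -h ltnNge leq_addr.
  rewrite mulr_sumr [LHS]big_mkcond; apply: eq_bigr => n _.
  rewrite -[in RHS](subnKC le) eqn_add2l; case: eqP => _; last by rewrite mulr0 mul0r.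
  by rewrite mulr1.
have h : eqmod ('X ^+ B) ((1 - 'X) ^+ k * S) (num_trunc%:R * Gpoly).
  rewrite /S /Gpoly !fsbig_finite // !mulr_sumr; apply: eqmod_sum => M _.
  rewrite mulrCA [X in eqmod _ _ X]mulrCA; apply: eqmodM; first exact: eqmod_refl.
  apply: series_lpoly => //; first exact: (dual_submod HR _ _).1.
  exact: (zO_dual0 HR).
have := coef_eqmod h jB; rewrite -(rmorph_nat polyC num_trunc) coefCM => <-.
rewrite coefM -fps_of_poly1X [LHS]mulr_sumr; apply: eq_bigr => i _.
have lt : (j - i < B)%N by apply: leq_ltn_trans (leq_subr _ _) jB.
by rewrite (hS _ lt) [RHS]mulrCA.
Qed.

Lemma ideal_series_low e : (e < cod R)%N -> ideal_series e = 0.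
Proof.
move=> lt; rewrite /= (_ : ideals e = set0) ?fsbig_set0 //.
apply/seteqP; split=> // J [mJ JR oJ cJ]; exfalso.
have := cod_le oJ (pr_sub HR) JR; rewrite cJ leqNgt lt //.
Qed.

(** Shifting by cod R turns the codimension of an ideal in O into its degree. *)
Definition Lpoly : {poly E} :=
  \poly_(j < size Gpoly) ((num_trunc%:R / num_units%:R : rat)%:P * Gpoly`_(cod R + j)).

Lemma num_units_neq0 : num_units%:R != 0 :> rat.
Proof. by rewrite pnatr_eq0 -lt0n (@count_unit_gt0 F k c). Qed.

Lemma Lseries_Gpoly j :
  ((1 - fps_X) ^+ k * ideal_series) j = (num_trunc%:R / num_units%:R : rat)%:P * Gpoly`_j.
Proof.
have U0 : num_units%:R%:P != 0 :> E by rewrite polyC_eq0 num_units_neq0.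
apply: (mulfI U0); rewrite mulrA -rmorphM /= mulrCA divff ?num_units_neq0 // mulr1.
by rewrite !rmorph_nat series_Gpoly.
Qed.

Lemma Gpoly_low e : (e < cod R)%N -> Gpoly`_e = 0.
Proof.
move=> lt; have := series_Gpoly e.
have -> : ((1 - fps_X) ^+ k * ideal_series) e = 0.
  rewrite -[LHS]/(\sum_(i < e.+1) ((1 - fps_X : fps E) ^+ k) i * ideal_series (e - i)%N).
  apply: big1 => i _; rewrite ideal_series_low ?mulr0 //.
  by apply: leq_ltn_trans (leq_subr _ _) lt.
rewrite mulr0 => /esym/eqP; rewrite mulf_eq0 => /orP[|/eqP //].
by rewrite -(rmorph_nat polyC num_trunc) polyC_eq0 pnatr_eq0 -[_ == _]negbK -lt0n num_trunc_gt0.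
Qed.

Lemma Lpoly_coef j : Lpoly`_j = (num_trunc%:R / num_units%:R : rat)%:P * Gpoly`_(cod R + j).
Proof.
rewrite coef_poly; case: ltnP => // le.
by rewrite [Gpoly`__]nth_default ?mulr0 // (leq_trans le) // leq_addl.
Qed.

Lemma Lpoly_Gpoly : 'X ^+ cod R * Lpoly = (num_trunc%:R / num_units%:R : rat)%:P%:P * Gpoly.
Proof.
apply/polyP => e; rewrite coefXnM coefCM; case: ltnP => [lt|le].
  by rewrite Gpoly_low // mulr0.
by rewrite Lpoly_coef subnKC.
Qed.

Lemma Lpoly_series :
  fps_of_poly Lpoly =
  (1 - fps_X) ^+ k * Fps (fun d => \sum_(J \in ideals (cod R + d)) f (rk J)).
Proof.
apply/fpsP => j; rewrite [LHS]/= Lpoly_coef -Lseries_Gpoly -!fps_of_poly1X.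
pose u := fps_of_poly ((1 - 'X) ^+ k : {poly E}).
rewrite -/u -[LHS]/(\sum_(i < (cod R + j).+1) u i * ideal_series (cod R + j - i)%N).
rewrite -[RHS]/(\sum_(i < j.+1) u i * ideal_series (cod R + (j - i))%N).
have -> : (cod R + j).+1 = (j.+1 + cod R)%N by rewrite addSn addnC.
rewrite big_split_ord /= [X in _ + X]big1 => [|i _].
  rewrite [LHS]addr0; apply: eq_bigr => i _; congr (_ * ideal_series _).
  by rewrite addnBA // -ltnS; apply: ltn_ord.
rewrite [X in _ * X](_ : _ = 0) ?mulr0 //.
apply: (@ideal_series_low (cod R + j - (j.+1 + i))%N).
by have := ltn_ord i; lia.
Qed.

End LFunction.

(** * The functional equation *)

Lemma rmorph_theta (E L : comNzRingType) (h : {rmorphism E -> L}) r X c a :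
  h (theta r X c a) = theta (h r) (h X) c a.
Proof.
rewrite /theta; case: (a == 0%N); first by case: (c == 0%N); rewrite rmorphB rmorph1.
by rewrite !rmorphM rmorphXn rmorphB; case: (a < c)%N; rewrite ?rmorphB ?rmorph1.
Qed.

Section FunctionalEquation.
Variables (F : finFieldType) (k : nat).
Notation O := ('I_k -> fps F).
Notation mi := ('I_k -> nat).
Variables (R : set O) (gam : mi) (x' y' p q : O) (c : mi).
Hypothesis HR : plane_ring R gam x' y' p q c.
Variable i0 : 'I_k.
Variable f : nat -> {poly rat}.
Notation submod := (submod R).
Notation dual0 := (dual0 R).
Notation rk := (rk gam x' y').
Notation normalized := (normalized R).
Notation clevel := (clevel c).
Notation E := {poly rat}.
Notation lpoly := (lpoly (F := F) (k := k) c).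

(** If u lies in N then z^n u lies in M*, so the product of z^n M and N is contained in R.
    The codimensions of z^n M and of N* agree. *)
Lemma dual0_normalized_shift M N n : normalized M -> normalized N ->
  dual0 M = zshift n N -> dual0 N = zshift n M.
Proof.
move=> hM hN e.
have [mM _] := hM; have [mN _] := hN.
have zM := normalized_zO HR hM; have zN := normalized_zO HR hN.
have oM := normalized_open HR hM; have oN := normalized_open HR hN.
apply/esym/cod_eq; [exact: open_zshift|exact: (dual_submod HR _ _).1| |].
  move=> _ [v Mv ->]; apply/dual0E => u Nu.
  have h : dual0 M (zpow F n * u) by rewrite e; exists u.
  have -> : zpow F n * v * u = zpow F n * u * v by ring.
  exact: (iffLR (dual0E _ _ _) h).
have := cod_dual0 HR i0 mM zM; have := cod_dual0 HR i0 mN zN.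
rewrite e !cod_zshift //; lia.
Qed.

Definition shift_of (J : set O) : mi :=
  xget (fun=> 0%N) [set n | exists M, normalized M /\ J = zshift n M].

Lemma shift_ofE n M : normalized M -> shift_of (zshift n M) = n.
Proof.
move=> hM; apply: xget_unique; first by exists M.
by move=> n' [M' [hM' e]]; case: (zshift_inj hM hM' e).
Qed.

Definition normalized_dual (M : set O) : set O :=
  [set v | dual0 M (zpow F (shift_of (dual0 M)) * v)].

Lemma normalized_dualP M : normalized M ->
  exists n, [/\ normalized (normalized_dual M), dual0 M = zshift n (normalized_dual M) &
    dual0 (normalized_dual M) = zshift n M].
Proof.
move=> hM; have mD := dual_submod HR (fun=> 0%N) M.
have [n [N [hN e]]] := normalized_exists mD (open_dual HR _ _).
have eN : normalized_dual M = N by rewrite /normalized_dual [dual0 M]e shift_ofE // zshift_preim.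
by exists n; rewrite eN; split=> //; apply: dual0_normalized_shift.
Qed.

Lemma normalized_dualK M : normalized M -> normalized_dual (normalized_dual M) = M.
Proof.
move=> hM; have [n [hs _ e]] := normalized_dualP hM.
by rewrite {1}/normalized_dual e shift_ofE // zshift_preim.
Qed.

Lemma normalized_dual_bij : set_bij normalized normalized normalized_dual.
Proof.
split.
- by move=> M /normalized_dualP[n []].
- by move=> M M'; rewrite !inE => hM hM' /(congr1 normalized_dual); rewrite !normalized_dualK.
- move=> M hM; exists (normalized_dual M); last by rewrite normalized_dualK.
  by have [n []] := normalized_dualP hM.
Qed.

Section Eval.
Variables (L : fieldType) (g : {rmorphism E -> L}).
Notation qL := (#|F|%:R : L).
Hypothesis qL0 : qL != 0.
Variable T : L.
Hypothesis T0 : T != 0.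

Definition ev (u : L) (P : {poly E}) : L := (map_poly g P).[u].

Lemma ev_is_zmod u : zmod_morphism (ev u).
Proof. by move=> P1 P2; rewrite /ev rmorphB hornerD hornerN. Qed.
Lemma ev_is_monoid u : monoid_morphism (ev u).
Proof. by split; [rewrite /ev rmorph1 hornerC | move=> P1 P2; rewrite /ev rmorphM hornerM]. Qed.
HB.instance Definition _ u := GRing.isZmodMorphism.Build {poly E} L (ev u) (ev_is_zmod u).
HB.instance Definition _ u := GRing.isMonoidMorphism.Build {poly E} L (ev u) (ev_is_monoid u).

Lemma evC u a : ev u a%:P = g a. Proof. by rewrite /ev map_polyC hornerC. Qed.
Lemma evX u : ev u 'X = u. Proof. by rewrite /ev map_polyX hornerX. Qed.

Lemma g_rat (a : rat) n : g (a ^- n)%:P = (g a%:P) ^- n.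
Proof.
have h : (fun a : rat => g a%:P) = (g \o polyC) by [].
by rewrite -[LHS]/((g \o polyC) (a ^- n)) fmorphV rmorphXn.
Qed.

Lemma g_qn : g (qn F)%:P = qL. Proof. by rewrite /qn !rmorph_nat. Qed.

Lemma g_qnV : g ((qn F)^-1)%:P = qL^-1.
Proof. by have := g_rat (qn F) 1; rewrite !expr1 g_qn. Qed.

Definition lvalue (u : L) (N : set O) : L :=
  local_poly qL^-1 u c clevel (fun n => g (vol N n)%:P).

Lemma ev_lpolyE u N : ev u (lpoly N) = lvalue u N.
Proof.
rewrite /lpoly /lvalue /local_poly rmorph_sum; apply: eq_bigr => m _.
rewrite rmorphM rmorph_prod /= evC; congr (_ * _); apply: eq_bigr => i _.
by rewrite rmorph_theta /= evC evX g_qnV.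
Qed.

(** The functional equation of a single local zeta integral. *)
Lemma lvalue_dual N : submod N -> zO c `<=` N ->
  lvalue (qL * T)^-1 N * T ^+ wt c = qL ^- cod N * lvalue T (dual0 N).
Proof.
move=> mN zN; apply: local_poly_reflect => //; first exact: c_lt_clevel.
  by move=> n n' /funext ->.
move=> n nc; rewrite /vol !g_rat !g_qn.
have e := colon_cod_dual HR i0 mN zN nc.
rewrite mulrAC -mulrA -invfM -exprD addnC -e exprD invfM mulrCA mulfV ?mulr1 //.
by rewrite expf_neq0.
Qed.

Definition Gvalue (u : L) : L := ev u (Gpoly R gam x' y' c f).

Lemma GvalueE u : Gvalue u = \sum_(M \in normalized) g (f (rk M)) * u ^+ cod M * lvalue u (dual0 M).
Proof.
have fin := finite_normalized HR.
rewrite /Gvalue /Gpoly !fsbig_finite // rmorph_sum; apply: eq_bigr => M _.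
by rewrite !rmorphM rmorphXn /= evC evX ev_lpolyE.
Qed.

(** The local functional equations replace each term of M* by the term of M, and the
    involution [normalized_dual] reorders the sum. *)
Lemma Gvalue_reflect :
  Gvalue (qL * T)^-1 * (qL ^+ wt c * T ^+ (wt c + wt c)) = Gvalue T.
Proof.
have fin := finite_normalized HR.
rewrite [RHS]GvalueE (reindex_fsbig normalized_dual normalized _ _ normalized_dual_bij) GvalueE.
rewrite !fsbig_finite // mulr_suml -!fsbig_finite //; apply: eq_fsbigr => M; rewrite inE => hM.
have [n [hs e1 e2]] := normalized_dualP hM.
have [mM _] := hM; have zM := normalized_zO HR hM.
have oM := normalized_open HR hM; have os := normalized_open HR hs.
have mD := dual_submod HR (fun=> 0%N) M.
have rks : rk (normalized_dual M) = rk M.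
  by rewrite -(rk_zshift HR n os) -e1 (rk_dual0 HR i0).
have zz : zO c `<=` zshift n M by rewrite -e2; exact: (zO_dual0 HR).
have Ps : lvalue T (dual0 (normalized_dual M)) = T ^+ wt n * lvalue T M.
  by rewrite -!ev_lpolyE e2 (lpoly_zshift mM.1 zM zz) rmorphM rmorphXn /= evX.
have cs : (cod (dual0 M) = cod (normalized_dual M) + wt n)%N by rewrite e1 cod_zshift.
have cM := cod_dual0 HR i0 mM zM.
rewrite rks Ps -[RHS]mulrA -[LHS]mulrA -[LHS]mulrA; congr (_ * _).
have PD := lvalue_dual mD (@zO_dual0 _ _ _ _ _ _ _ _ _ HR M); rewrite (dual0K HR i0) // in PD.
rewrite [RHS]mulrA -exprD -cs.
transitivity ((qL * T)^-1 ^+ cod M * (qL ^+ wt c * T ^+ wt c) *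
   (lvalue (qL * T)^-1 (dual0 M) * T ^+ wt c)); first by rewrite exprD; ring.
rewrite PD mulrA; congr (_ * _); rewrite -cM !exprD exprVn exprMn.
by field; rewrite !expf_neq0.
Qed.

Lemma ev_Lpoly_reflect :
  qL ^+ cod R * T ^+ (2 * cod R) * ev (qL * T)^-1 (Lpoly R gam x' y' c f) =
  ev T (Lpoly R gam x' y' c f).
Proof.
pose a : rat := (num_trunc F c)%:R / (num_units F c)%:R.
have h u : u ^+ cod R * ev u (Lpoly R gam x' y' c f) = g a%:P * Gvalue u.
  have := congr1 (ev u) (Lpoly_Gpoly HR f).
  by rewrite [LHS]rmorphM [RHS]rmorphM rmorphXn /= evX evC.
have cR := cod_R HR i0.
apply: (mulfI (expf_neq0 (cod R) T0)).
rewrite [RHS]h -Gvalue_reflect -cR.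
have hu := h (qL * T)^-1.
have e : ev (qL * T)^-1 (Lpoly R gam x' y' c f) = (qL * T) ^+ cod R * (g a%:P * Gvalue (qL * T)^-1).
  by rewrite -hu exprVn mulVKf // ?expf_neq0 ?mulf_neq0.
rewrite e mul2n -addnn !exprD exprMn; ring.
Qed.

End Eval.
End FunctionalEquation.

(** * Lattice data of a ring generated by two power series *)

Section FpsSplit.
Variable A : nzRingType.

Lemma fps_constM (a : A) (f : fps A) j : (fps_const a * f) j = a * f j.
Proof.
rewrite [LHS]/= big_ord_recl subn0 big1 ?addr0 // => i _; by rewrite mul0r.
Qed.

Lemma fps_XM (f : fps A) j : (fps_X * f) j = if j is j'.+1 then f j' else 0.
Proof.
case: j => [|j]; rewrite [LHS]/=; first by rewrite big_ord1 mul0r.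
rewrite big_ord_recl mul0r add0r big_ord_recl /= mul1r subSS subn0 big1 ?addr0 // => i _.
by rewrite mul0r.
Qed.

End FpsSplit.

Lemma fps2_split (A : nzRingType) (f : fps2 A) : exists a f1 f2,
  f = fps2_const a + (fps2_x * f1 + fps2_y * f2).
Proof.
exists (f 0%N 0%N), (fps_const (Fps (fun i => f 0%N i.+1))), (Fps (fun j => f j.+1)).
apply/fpsP => j; rewrite -[RHS]/(fps2_const _ j + ((fps2_x * _) j + (fps2_y * _) j)).
rewrite fps_constM fps_XM; case: j => [|j] /=; last by rewrite mulr0 !add0r.
rewrite addr0; apply/fpsP => i; rewrite -[RHS]/(fps_const _ i + (fps_X * _) i) fps_XM.
by case: i => [|i] /=; rewrite ?addr0 ?add0r.
Qed.

Section Existence.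
Variables (F : fieldType) (k : nat).
Notation O := ('I_k -> fps F).
Notation mi := ('I_k -> nat).

Variables (R : set O).
Hypotheses (sR : subspace R) (R1 : R 1) (RM : forall u v, R u -> R v -> R (u * v)).

(** R is open, so each branch has a least exponent from which on all the series supported
    on that branch lie in R. *)
Lemma conductor_exists n : zO n `<=` R ->
  exists c : mi, forall u, (forall v, R (u * v)) <-> zO c u.
Proof.
move=> nR.
have /choice[c Hc] : forall i, exists d, (forall v, R (mono F i d * v)) /\
    forall d', (forall v, R (mono F i d' * v)) -> (d <= d')%N.
  move=> i; have ex : exists d, `[< forall v, R (mono F i d * v) >].
    exists (n i); apply/asboolP => v; apply: nR => j l lj; rewrite mono_mulE.
    by case: eqP => [e|] //; rewrite zpowE -e lj.
  case: (ex_minnP ex) => d /asboolP hd dmin; exists d; split=> // d' h.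
  by apply: dmin; apply/asboolP.
exists c => u; split=> [hu i j jc|hu v].
  apply: contrapT => uj.
  have [|d ud dmin] := @fps_val F (u i); first by move=> e; apply: uj; rewrite e.
  have dc : (d < c i)%N.
    by rewrite (leq_ltn_trans _ jc) // leqNgt; apply/negP => /dmin.
  have [|g Hg] := @fps_unit F (Fps (fun l => u i (l + d)%N)); first exact: ud.
  have := (Hc i).2 d; rewrite leqNgt dc => h; apply: notF; apply: h => v.
  have -> : mono F i d * v = u * (fun j => if j == i then g * v i else 0).
    apply/funext => i'; rewrite mono_mulE -[RHS]/(u i' * (if i' == i then g * v i else 0)).
    case: eqP => [->|_]; last by rewrite mulr0.
    have -> : u i = zpow F (fun=> d) i * Fps (fun l => u i (l + d)%N).
      rewrite -[RHS]/((zpow F (fun=> d) * (fun i => Fps (fun l => u i (l + d)%N))) i).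
      apply/fpsP => l; rewrite zpowE; case: ltnP => [/dmin //|dl] /=; by rewrite subnK.
    by rewrite mulrA -[X in _ = X * _]mulrA Hg mulr1.
  exact: hu.
have hw : zO c (u * v) by rewrite mulrC; apply: zO_mulr.
have -> : u * v = \sum_i mono F i (c i) * zdiv c (u * v).
  rewrite -{1}(zdivK hw); apply/funext => j.
  rewrite (big_morph (fun f : O => f j) (id1 := 0) (op1 := +%R)) // (bigD1 j) //=.
  rewrite mono_mulE eqxx big1 ?addr0 // => i ij.
  by rewrite mono_mulE eq_sym (negPf ij).
by apply: (subspace_sum sR) => i _; apply: (Hc i).1.
Qed.

(** x and y cannot both vanish on a branch: R would then be constant on it, whereas R
    contains all series of high valuation. *)
Lemma plane_ring_exists (x y : O) n : zO n `<=` R -> R x -> R y ->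
  (forall i, x i 0%N = 0 /\ y i 0%N = 0) ->
  (forall r, R r -> exists a r1 r2, [/\ R r1, R r2 & r = a *: (1 : O) + (x * r1 + y * r2)]) ->
  exists gam x' y' p q c,
    [/\ plane_ring R gam x' y' p q c, zpow F gam * x' = x & zpow F gam * y' = y].
Proof.
move=> nR Rx Ry xy0 gen.
have xy_neq0 i : exists d, (x i d != 0) || (y i d != 0).
  apply: contrapT => no.
  have h d : x i d = 0 /\ y i d = 0.
    split; apply/eqP; rewrite -[_ == _]negbK; apply/negP => hx; apply: no; exists d.
      by rewrite hx.
    by rewrite hx orbT.
  have xi : x i = 0 by apply/fpsP => d; rewrite (h d).1.
  have yi : y i = 0 by apply/fpsP => d; rewrite (h d).2.
  have Rm : R (mono F i (n i).+1).
    apply: nR => j l lj /=; case: eqP => //= e; rewrite ltn_eqF //.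
    by rewrite e in lj; apply: ltnW.
  have [a [r1 [r2 [_ _ e]]]] := gen _ Rm.
  have := congr1 (fun u : O => u i (n i).+1) e.
  rewrite -[X in _ = X]/((a *: (1 : fps F) + (x i * r1 i + y i * r2 i)) (n i).+1).
  rewrite xi yi !mul0r !addr0 /=.
  by rewrite !eqxx mulr0 => /eqP; rewrite oner_eq0.
pose gam i := ex_minn (xy_neq0 i).
have gamP i : (x i (gam i) != 0) || (y i (gam i) != 0) by rewrite /gam; case: ex_minnP.
have gam_min i d : (d < gam i)%N -> x i d = 0 /\ y i d = 0.
  rewrite /gam; case: ex_minnP => g _ gmin dg.
  have : ~~ ((x i d != 0) || (y i d != 0)) by apply: contraL dg => /gmin; rewrite -leqNgt.
  by rewrite negb_or !negbK => /andP[/eqP -> /eqP ->].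
have zx : zO gam x by move=> i d /gam_min[].
have zy : zO gam y by move=> i d /gam_min[].
have /choice[pq Hpq] : forall i, exists pq : fps F * fps F,
    zdiv gam x i * pq.1 + zdiv gam y i * pq.2 = 1.
  move=> i; have /orP[h|h] := gamP i.
    by have [|g Hg] := @fps_unit F (zdiv gam x i); [exact: h|exists (g, 0); rewrite Hg mulr0 addr0].
  by have [|g Hg] := @fps_unit F (zdiv gam y i); [exact: h|exists (0, g); rewrite Hg mulr0 add0r].
have [c Hc] := conductor_exists nR.
exists gam, (zdiv gam x), (zdiv gam y), (fun i => (pq i).1), (fun i => (pq i).2), c.
rewrite !zdivK //; split=> //; split; rewrite ?zdivK //.
- move=> i; rewrite lt0n; apply/eqP => g0; have := gamP i; rewrite g0.
  by have [-> ->] := xy0 i; rewrite eqxx.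
- by apply/funext => i; apply: Hpq.
- move=> r /gen[a [r1 [r2 [Rr1 Rr2 ->]]]]; exists a, r1, r2; split=> //.
  by rewrite addrAC subrr add0r !zdivK.
Qed.

End Existence.

Section FiniteCodim.
Variables (F : fieldType) (k : nat).
Notation O := ('I_k -> fps F).
Notation mi := ('I_k -> nat).
Variables (R : set O) (gam : mi) (x' y' p q : O) (c : mi).
Hypothesis HR : plane_ring R gam x' y' p q c.
Variable i0 : 'I_k.

(** If no power w^j with j <= n of w = z^(c+1) were in J, then 1, w, ..., w^n would be
    independent modulo J, because a relation is a power of w times a unit of R.  So w^n
    lies in J, and w^n times the conductor is contained in J. *)
Lemma finite_quot_open J n : submod R J -> J `<=` R -> has_quot_dim R J n -> open J.
Proof.
move=> mJ JR hn; pose c1 : mi := fun i => (c i).+1; pose w : O := zpow F c1.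
have Rw : R w by apply: (condR HR) => i j ji /=; rewrite ltn_eqF // /c1 ltnS ltnW.
have w0 : w i0 0%N = 0 by [].
have wn : J (w ^+ n).
  apply: contrapT => nw; suff : (n.+1 <= n)%N by rewrite ltnn.
  apply: (quot_dim_indep (v := fun j : 'I_n.+1 => w ^+ j) mJ.1 _ _ hn) => [j|d Jd].
    exact: (R_exp HR).
  suff h j (jn : (j < n.+1)%N) : d 0 (Ordinal jn) = 0.
    by apply/rowP => -[j jn]; rewrite h mxE.
  elim/ltn_ind: j jn => j IH jn; apply/eqP/negPn/negP => dj.
  pose u : O := \sum_(l < n.+1) (if (l < j)%N then 0 else d 0 l *: w ^+ (l - j)).
  have eu : comb (fun j : 'I_n.+1 => w ^+ j) d = w ^+ j * u.
    rewrite /comb /u mulr_sumr; apply: eq_bigr => -[l ln] _ /=.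
    case: ltnP => lj; first by rewrite (IH l) // scale0r mulr0.
    by rewrite -scaleOM -exprD subnKC.
  have Ru : R u.
    apply: (subspace_sum (pr_sub HR)) => l _; case: ifP => _; first exact: subspace0 (pr_sub HR).
    by apply: subspaceZ; [exact: (pr_sub HR)|exact: (R_exp HR)].
  have u0 : u i0 0%N = d 0 (Ordinal jn).
    rewrite /u (big_morph (fun f : O => f i0) (id1 := 0) (op1 := +%R)) // fps_sumE.
    have tj : (if (j < j)%N then 0 else d 0 (Ordinal jn) *: w ^+ (j - j)) i0 0%N = d 0 (Ordinal jn).
      rewrite ltnn subnn expr0 -[LHS]/(d 0 (Ordinal jn) * 1); exact: mulr1.
    have tl (l : 'I_n.+1) : l != Ordinal jn ->
        (if (l < j)%N then 0 else d 0 l *: w ^+ (l - j)) i0 0%N = 0.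
      rewrite -val_eqE /= => lj; case: ltnP => // jl.
      have lj' : (j < l)%N by rewrite ltn_neqAle eq_sym lj.
      rewrite -[(l - j)%N]prednK ?subn_gt0 // exprS.
      rewrite -[LHS]/(d 0 l * (w * w ^+ (l - j).-1) i0 0%N) mulO_0 w0 mul0r; exact: mulr0.
    by rewrite (bigD1 (Ordinal jn)) // tj big1 //; exact: addr0.
  have [|u' Ru' uu'] := R_unit HR (i0 := i0) Ru; first by rewrite u0.
  apply: nw; have Jj : J (w ^+ j).
    by rewrite -[w ^+ j]mulr1 -uu' mulrA -eu mulrC; apply: mJ.2.
  by rewrite -(subnK (ltnSE jn)) exprD; apply: mJ.2 => //; exact: (R_exp HR).
split; first by case: mJ.
exists (addi (fun i => (c1 i * n)%N) c) => u hu.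
have wE : w ^+ n = zpow F (fun i => (c1 i * n)%N).
  elim: (n) => [|n' IH].
    by rewrite expr0 -zpow0; congr zpow; apply/funext => i; rewrite muln0.
  by rewrite exprS IH -zpowD; congr zpow; apply/funext => i; rewrite mulnS.
have zu : zO (fun i => (c1 i * n)%N) u by apply: zO_le hu => i; apply: leq_addr.
rewrite -(zdivK zu) -wE mulrC; apply: mJ.2 => //; apply: (condR HR) => i j ji /=.
by apply: hu; rewrite addnC ltn_add2l.
Qed.
End FiniteCodim.

(** * From the abstract ring to its image in the normalization *)

Section Transport.
Variables (F : finFieldType) (k : nat).
Notation O := ('I_k -> fps F).
Notation mi := ('I_k -> nat).
Variables (S : comAlgType F) (iota : {lrmorphism S -> O}).
Hypothesis iota_inj : injective iota.
Variables (gam : mi) (x' y' p q : O) (c : mi).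
Notation R := (range iota).
Hypothesis HR : plane_ring R gam x' y' p q c.
Variable i0 : 'I_k.
Variable m : set S.
Hypothesis m_max : maximal_ideal m.

(** By locality m is contained in the ideal of elements without constant term, which is
    proper. *)
Lemma maximal_idealE r : m r <-> iota r i0 0%N = 0.
Proof.
case: m_max => mI m1 mx; pose I0 : set S := [set r | iota r i0 0%N = 0].
have mI0 : m `<=` I0.
  move=> s ms; apply: contrapT => /eqP s0.
  have [_ [s' _ <-] e] := R_unit HR (i0 := i0) (imageT iota s) s0.
  apply: m1; have [_ _ mM] := mI; rewrite -(_ : s' * s = 1); first exact: mM.
  by apply: iota_inj; rewrite rmorphM rmorph1 mulrC.
rewrite -(mx I0) //; last by rewrite /I0 /= rmorph1 => /eqP; rewrite oner_eq0.
split; rewrite /I0 /=; first by rewrite rmorph0.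
- by move=> u v hu hv; rewrite rmorphD -[LHS]/(iota u i0 0%N + iota v i0 0%N) hu hv addr0.
- by move=> a u hu; rewrite rmorphM mulO_0 hu mulr0.
Qed.

Lemma ideal_submod J : is_ideal J -> submod R (iota @` J).
Proof.
move=> [J0 JD JM]; split.
  apply: (subspace_im iota); split=> // a u Ju.
  by rewrite -[u]mul1r scalerAl; apply: JM.
move=> _ _ [s _ <-] [u Ju <-]; exists (s * u); last by rewrite rmorphM.
exact: JM.
Qed.

Lemma iota_ideal_mul J : is_ideal J ->
  iota @` (ideal_mul m J) = mmul gam x' y' (iota @` J).
Proof.
move=> hJ; have mJ := ideal_submod hJ; apply/seteqP; split=> w.
  move=> [_ [n [u [v [uv ->]]]] <-]; rewrite rmorph_sum.
  apply: (subspace_sum (mmul_sub _ _ _ mJ.1)) => i _; have [mu Jv] := uv i.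
  have /maximal_idealE/(mmul_iff HR i0 (imageT iota _)) := mu.
  move=> [_ [_ [[a _ <-] [b _ <-] e]]]; rewrite rmorphM /= e.
  exists (iota (a * v i)), (iota (b * v i)); have [_ _ JM] := hJ.
  split; [by exists (a * v i) => //; apply: JM|by exists (b * v i) => //; apply: JM|].
  by rewrite !rmorphM; ring.
move=> [_ [_ [[a Ja <-] [b Jb <-] ->]]].
have [[X _ eX] [Y _ eY]] := (pr_x HR, pr_y HR).
have mem0 (u : O) : (zpow F gam * u) i0 0%N = 0 by apply: zO_zpow; exact: (pr_gam HR).
exists (X * a + Y * b); last by rewrite rmorphD !rmorphM /= eX eY.
exists 2, (fun i : 'I_2 => if i == 0 then X else Y), (fun i : 'I_2 => if i == 0 then a else b).
split; last by rewrite big_ord_recl big_ord1.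
by move=> i; case: (i == 0); split=> //; apply/maximal_idealE; rewrite ?eX ?eY.
Qed.

Lemma iota_mem (A : set S) u : (iota @` A) (iota u) <-> A u.
Proof. by split=> [[v Av /iota_inj <-]|Au] //; exists u. Qed.

Lemma quot_dim_iota (A B : set S) n : subspace A -> subspace (iota @` B) ->
  has_quot_dim A B n <-> has_quot_dim (iota @` A) (iota @` B) n.
Proof.
move=> sA sB; apply: (@quot_dim_iso _ _ _ iota) => //.
- by move=> u Au; exists u.
- by move=> _ [u Au <-]; exists u => //; rewrite subrr; apply: subspace0.
- by move=> u _; split=> /iota_mem.
Qed.

Lemma subspace_iota (A : set S) : subspace (iota @` A) -> subspace A.
Proof.
move=> sA; have -> : A = iota @^-1` (iota @` A).
  by apply/seteqP; split=> u; rewrite /preimage /= => /iota_mem.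
exact: (subspace_preim iota sA).
Qed.

Lemma ideal_rank_iota J : is_ideal J -> open (iota @` J) ->
  ideal_rank m J = rk gam x' y' (iota @` J).
Proof.
move=> hJ oJ; have mJ := ideal_submod hJ.
have e := iota_ideal_mul hJ.
have sM : subspace (iota @` ideal_mul m J) by rewrite e; exact: mmul_sub mJ.1.
apply: quot_dim_eq; first exact: subspace_iota.
apply/quot_dim_iota => //; first exact: subspace_iota mJ.1.
by rewrite e; apply: (rk_quot HR).
Qed.

(** That the image of an ideal of finite codimension is open is [finite_quot_open]. *)
Lemma ideals_of_degree_bij d :
  set_bij (@ideals_of_degree F S d) (ideals R (cod R + d)) (fun J => iota @` J).
Proof.
have sR := pr_sub HR; have oR := openR HR.
have quotR J : submod R (iota @` J) ->
    has_quot_dim setT J d <-> has_quot_dim R (iota @` J) d.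
  move=> mJ; apply: quot_dim_iota; [exact: subspaceT | exact: mJ.1].
have sub J : iota @` J `<=` R by move=> _ [u _ <-]; exists u.
split.
- move=> J [hJ dJ]; have mJ := ideal_submod hJ.
  have dJ' := iffLR (quotR _ mJ) dJ.
  have oJ := finite_quot_open HR i0 mJ (sub J) dJ'.
  by split=> //; apply/(cod_quot _ oJ sR (sub J)).
- move=> J J' _ _ e; apply/seteqP; split=> u.
    by move=> Ju; apply/iota_mem; rewrite -[X in X _]e; apply/iota_mem.
  by move=> Ju; apply/iota_mem; rewrite [X in X _]e; apply/iota_mem.
- move=> J [mJ JR oJ cJ].
  have e : iota @` (iota @^-1` J) = J.
    apply/seteqP; split=> u; first by move=> [v Jv <-].
    by move=> /[dup] Ju /JR[v _ ev]; exists v; rewrite /preimage /= ?ev.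
  exists (iota @^-1` J) => //; split; last first.
    by apply/quotR; rewrite e //; apply/(cod_quot _ oJ sR JR).
  have [sJ hJ] := mJ; split; rewrite /preimage /=.
  + by rewrite rmorph0; apply: subspace0.
  + by move=> u v Ju Jv; rewrite rmorphD; apply: subspaceD.
  + by move=> a u Ju; rewrite rmorphM; apply: hJ => //; exists a.
Qed.

Lemma Z_series_iota :
  Z_series m = Fps (fun d => \sum_(J \in ideals R (cod R + d)) rank_weight F (rk gam x' y' J)).
Proof.
apply/fpsP => d /=; rewrite (reindex_fsbig _ _ _ _ (ideals_of_degree_bij d)).
apply: eq_fsbigr => J; rewrite inE => /[dup] -[hJ _] dJ.
have [hb _ _] := ideals_of_degree_bij d; have [_ _ oJ _] := hb _ dJ.
by rewrite ideal_rank_iota.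
Qed.

End Transport.

Theorem theorem9p4
  (F : finFieldType)
  (K : closedFieldType) (FtoK : {rmorphism F -> K})
  (K_algebraic : integralRange FtoK)
  (kappa : nat) (kappa_gt0 : (0 < kappa)%N)
  (P : 'I_kappa -> {poly {poly F}})
  (P_irreducible : forall i,
    irreducible_elt (fps2_of_poly (map_poly (map_poly FtoK) (P i))))
  (P_nonproportional : forall i j, i != j ->
    forall c : F, P i <> c%:P *: P j)
  (R : comAlgType F) (pi : {rmorphism fps2 F -> R})
  (pi_const : forall c : F, pi (fps2_const c) = c%:A)
  (pi_surjective : forall r : R, exists f, pi f = r)
  (pi_kernel : forall f,
    pi f = 0 <-> principal_ideal (\prod_i fps2_of_poly (P i)) f)
  (iota : {lrmorphism R -> ('I_kappa -> fps F)})
  (iota_normalization : is_normalization iota)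
  (iota_xy : forall i,
    iota (pi fps2_x) i 0%N = 0 /\ iota (pi fps2_y) i 0%N = 0)
  (branch_kernel : forall i f,
    iota (pi f) i = 0 <-> principal_ideal (fps2_of_poly (P i)) f)
  (branch_fractions : forall i (g : fps F), exists s r : R,
    iota s i <> 0 /\ iota s i * g = iota r i)
  (m : set R) (m_maximal : maximal_ideal m)
  (delta : nat)
  (delta_dim : has_quot_dim [set: 'I_kappa -> fps F] (range iota) delta) :
  exists L : {poly {poly rat}},
    fps_of_poly L = L_series m kappa /\
    #|F|%:R ^+ delta * ratfun_t ^+ (2 * delta)
      * subst_t L (#|F|%:R * ratfun_t)^-1 = subst_t L ratfun_t.
Proof.
have [iota_inj iota_lreg iota_frac _ _] := iota_normalization.
pose O := 'I_kappa -> fps F.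
pose i0 : 'I_kappa := Ordinal kappa_gt0.
have sR : subspace (range iota) by apply: (subspace_im iota); exact: subspaceT.
have [n nR] : exists n, zO n `<=` range iota.
  have [v [_ vspan _]] := delta_dim.
  have /choice[s Hs] : forall i, exists s, GRing.lreg s /\ exists a, iota s * v i = iota a.
    by move=> i; have [s [a [ls e]]] := iota_frac (v i); exists s; split=> //; exists a.
  (* A common denominator of a basis of O / R multiplies O into R. *)
  pose s0 := \prod_i s i.
  have ls0 : GRing.lreg s0.
    apply: (big_ind (fun s => GRing.lreg s)); [exact: lreg1|exact: lregM|].
    by move=> i _; case: (Hs i).
  have s0R (u : O) : range iota (iota s0 * u).
    have [a [r _ er]] := vspan u I; rewrite -(subrK (\sum_(i < delta) a i *: v i) u) -er mulrDr.
    apply: (subspaceD sR); first by exists (s0 * r); rewrite // rmorphM.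
    rewrite mulr_sumr; apply: (subspace_sum sR) => i _; rewrite -scaleOM; apply: (subspaceZ sR).
    have [_ [b eb]] := Hs i; exists ((\prod_(j | j != i) s j) * b) => //.
    have -> : s0 = s i * \prod_(j | j != i) s j by rewrite /s0 (bigD1 i).
    by rewrite !rmorphM /= -eb; ring.
  have [|n [u [u0 eu]]] := @O_factor F kappa (iota s0).
    move=> i si; have := iota_lreg _ ls0 (mono F i 0) 0; rewrite mulr0 => h.
    have /h : iota s0 * mono F i 0 = 0.
      apply/funext => j; rewrite mulrC; apply/fpsP => l; rewrite mono_mul.
      by case: eqP => [->|//]; rewrite si.
    move=> /(congr1 (fun u : O => u i 0%N)) /eqP; rewrite /= !eqxx => /eqP.
    by apply/eqP; exact: oner_neq0.
  have [u' Hu'] := O_unit u0; exists n => w hw.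
  rewrite -(zdivK hw) -[zdiv n w]mul1r -Hu' -mulrA mulrA -eu; exact: s0R.
have Rx : range iota (iota (pi fps2_x)) by exists (pi fps2_x).
have Ry : range iota (iota (pi fps2_y)) by exists (pi fps2_y).
have R1 : range iota 1 by exists 1; rewrite // rmorph1.
have RM u v : range iota u -> range iota v -> range iota (u * v).
  by move=> [a _ <-] [b _ <-]; exists (a * b); rewrite // rmorphM.
have gen (r : O) : range iota r -> exists a r1 r2, [/\ range iota r1, range iota r2 &
    r = a *: (1 : O) + (iota (pi fps2_x) * r1 + iota (pi fps2_y) * r2)].
  move=> [r' _ <-]; have [f <-] := pi_surjective r'; have [a [f1 [f2 ->]]] := fps2_split f.
  exists a, (iota (pi f1)), (iota (pi f2)); split; [by exists (pi f1)|by exists (pi f2)|].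
  by rewrite !rmorphD !rmorphM /= pi_const linearZ /= rmorph1.
have [gam [x' [y' [p [q [c [HR _ _]]]]]]] := plane_ring_exists sR R1 RM nR Rx Ry iota_xy gen.
have dR : cod (range iota) = delta by apply: codE.
exists (Lpoly (range iota) gam x' y' c (rank_weight F)); split.
  by rewrite (Lpoly_series HR) /L_series (Z_series_iota iota_inj HR i0 m_maximal).
pose g : {rmorphism {poly rat} -> ratfun} := (@tofrac {poly {poly rat}}) \o polyC.
have q0 : #|F|%:R != 0 :> ratfun.
  rewrite -(rmorph_nat (@tofrac {poly {poly rat}})) tofrac_eq0 natp_neq0 //.
  by apply/card_gt0P; exists 0.
have T0 : ratfun_t != 0 by rewrite /ratfun_t tofrac_eq0 polyX_eq0.
have := ev_Lpoly_reflect HR i0 (rank_weight F) g q0 T0.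
by rewrite dR.
Qed.
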